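(* Let $\eta,\eta_c:\mathbb{R}^{p}\to\mathbb{R}$, $p=p_1+p_2$, and let $X\in\mathbb{R}^{p_1}$, $Z\in\mathbb{R}^{p_2}$ be independent random vectors. Let $Z'$ be a copy of $Z$ (same distribution) independent of $(X,Z)$. Put $$Y=\eta(X,Z),\quad Y'=\eta(X,Z'),\quad Y_c=\eta_c(X,Z),\quad Y'_c=\eta_c(X,Z'),$$ $$S=\frac{\mathrm{Var}(\mathbb{E}(Y|X))}{\mathrm{Var}\,Y},\qquad S_c=\frac{\mathrm{Var}(\mathbb{E}(Y_c|X))}{\mathrm{Var}\,Y_c},$$ where $\mathrm{Var}\,Y$ and $\mathrm{Var}\,Y_c$ are finite and nonzero. Define the random variables $$A=(Y-\mathbb{E}(Y))(Y'-\mathbb{E}(Y)),\qquad B=S\left[(Y-\mathbb{E}(Y))^2+(Y'-\mathbb{E}(Y))^2\right],$$ $$A_c=(Y_c-\mathbb{E}(Y_c))(Y_c'-\mathbb{E}(Y_c)),\qquad B_c=S_c\left[(Y_c-\mathbb{E}(Y_c))^2+(Y_c'-\mathbb{E}(Y_c))^2\right],$$ and the nonnegative numbers $\sigma_c,\sigma_e$ by $$\sigma_c^2=\frac{\mathrm{Var}(A_c-B_c/2)}{(\mathrm{Var}\,Y_c)^2},$$ $$\sigma_e^2=\sigma_c^2+\frac{\mathrm{Var}(A-B/2)}{(\mathrm{Var}\,Y)^2}-\frac{2\,\mathrm{Cov}(A,A_c)-\left(\mathrm{Cov}(A,B_c)+\mathrm{Cov}(B,A_c)\right)+\mathrm{Cov}(B,B_c)/2}{\mathrm{Var}\,Y\;\mathrm{Var}\,Y_c},$$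 all variances and covariances appearing in these formulas being finite. For $a\in\,]0,1[$ let $q(a)=\Phi^{-1}(1-a/2)$, where $\Phi$ is the cumulative distribution function of the Gaussian distribution with zero mean and unit variance. Let $\psi:\mathbb{N}\to\mathbb{N}$ satisfy $\lim_{N\to+\infty}\psi(N)=+\infty$, and let $V_N=T_N+E_N$ be the variance-reduced estimator of $S$ defined in the context. Then, for any $\alpha_e$ and $\alpha_c$ in $]0,1[$, $$\lim_{N\to+\infty}P\left(|S-V_N|\le q(\alpha_e)\frac{\sigma_e}{\sqrt{\psi(N)}}+q(\alpha_c)\frac{\sigma_c}{\sqrt N}\right)\ge 1-(\alpha_e+\alpha_c).$$ The same holds when $\sigma_c$ and $\sigma_e$ are replaced by any consistent estimators of them.
   Context: For a finite family of pairs of real numbers $(y_i,y_i')_{i=1,\dots,n}$ define the pick-freeze statistic $$T\big((y_i,y_i')_{i\le n}\big)=\frac{\frac1n\sum_{i=1}^n y_iy_i'-\left(\frac1n\sum_{i=1}^n\frac{y_i+y_i'}{2}\right)^2}{\frac1n\sum_{i=1}^n\frac{y_i^2+(y_i')^2}{2}-\left(\frac1n\sum_{i=1}^n\frac{y_i+y_i'}{2}\right)^2}.$$ For each $N$, the estimator $V_N$ is built from copies of the triple $(X,Z,Z')$ as follows. (1) $T_N=T\big((Y_{ci},Y_{ci}')_{i\le N}\big)$, where $(Y_{ci},Y'_{ci})=(\eta_c(X_i,Z_i),\eta_c(X_i,Z_i'))$ and $(X_i,Z_i,Z_i')_{i\le N}$ are $N$ i.i.d. copies of $(X,Z,Z')$.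 This uses $2N$ evaluations of $\eta_c$ and estimates $S_c$. (2) Let $(\tilde X_i,\tilde Z_i,\tilde Z_i')_{i\le\psi(N)}$ be a further sample of $\psi(N)$ i.i.d. copies of $(X,Z,Z')$, evaluated separately from the sample in (1). Set $$E_N=T^{\eta}_{\psi(N)}-T_{\psi(N)},$$ where $T^{\eta}_{\psi(N)}=T\big((\eta(\tilde X_i,\tilde Z_i),\eta(\tilde X_i,\tilde Z_i'))_{i\le\psi(N)}\big)$ and $T_{\psi(N)}=T\big((\eta_c(\tilde X_i,\tilde Z_i),\eta_c(\tilde X_i,\tilde Z_i'))_{i\le\psi(N)}\big)$. Both terms of $E_N$ use the same input sample. This uses $2\psi(N)$ evaluations of $\eta$ and $2\psi(N)$ evaluations of $\eta_c$, and estimates $E=S-S_c$. (3) $V_N=T_N+E_N$. It uses $2(N+\psi(N))$ evaluations of $\eta_c$ and $2\psi(N)$ evaluations of $\eta$ in total. The functions $\eta$ and $\eta_c$ are such that $Y,Y',Y_c,Y_c'$ are random variables.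
   Formalization: The limit, which need not exist, is read as a lower limit; σ_e is assumed positive, since the claim can fail for σ_e = 0; and when σ_c = 0 the estimators of σ_c are assumed nonnegative. *)

(* Defs.v *)
From HB Require Import structures.
From mathcomp Require Import all_boot all_order all_algebra.
From mathcomp Require Import all_classical all_reals all_analysis.

Set Implicit Arguments.
Unset Strict Implicit.
Unset Printing Implicit Defensive.

Import Order.TTheory GRing.Theory Num.Theory.
Import numFieldNormedType.Exports.

Local Open Scope classical_set_scope.
Local Open Scope ring_scope.

(* Vectors of R^p are p-tuples: the sigma-algebra on p.-tuple R is the one
   generated by the coordinates, that is the Borel sigma-algebra of R^p. *)

Definition concat (R : Type) (p1 p2 : nat)
  (x : p1.-tuple R) (z : p2.-tuple R) : (p1 + p2).-tuple R := [tuple of x ++ z].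

Definition var (d : measure_display) (T : measurableType d) (R : realType)
  (P : probability T R) (X : T -> R) : R := fine 'V_P[X].

Definition cov (d : measure_display) (T : measurableType d) (R : realType)
  (P : probability T R) (X Y : T -> R) : R := fine (covariance P X Y).

Definition same_law (d dU : measure_display) (T : measurableType d)
  (U : measurableType dU) (R : realType) (P : probability T R)
  (X Y : T -> U) : Prop :=
  forall A, measurable A -> P (X @^-1` A) = P (Y @^-1` A).

Definition independent2 (d dU dV : measure_display) (T : measurableType d)
  (U : measurableType dU) (V : measurableType dV) (R : realType)
  (P : probability T R) (X : T -> U) (Y : T -> V) : Prop :=
  forall A B, measurable A -> measurable B ->
    P (X @^-1` A `&` Y @^-1` B) = (P (X @^-1` A) * P (Y @^-1` B))%E.

(* The A i may be setT, so the product rule for subfamilies is included. *)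
Definition mutually_independent (d dU : measure_display) (T : measurableType d)
  (U : measurableType dU) (R : realType) (P : probability T R)
  (n : nat) (xi : 'I_n -> T -> U) : Prop :=
  forall A : 'I_n -> set U, (forall i, measurable (A i)) ->
    P (\bigcap_(i in [set: 'I_n]) xi i @^-1` A i)
    = (\prod_(i < n) P (xi i @^-1` A i))%E.

Definition iid_copies (d dU : measure_display) (T : measurableType d)
  (U : measurableType dU) (R : realType) (P : probability T R)
  (n : nat) (xi : 'I_n -> T -> U) (W : T -> U) : Prop :=
  mutually_independent P xi /\ forall i, same_law P (xi i) W.

(* G is a version of the conditional expectation E(Y | X). *)
Definition is_cond_expectation (d dU : measure_display) (T : measurableType d)
  (U : measurableType dU) (R : realType) (P : probability T R)
  (X : T -> U) (Y : T -> R) (G : T -> R) : Prop :=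
  [/\ forall B, measurable B -> g_sigma_algebra_preimage X (G @^-1` B),
      P.-integrable setT (EFin \o G) &
      forall A, g_sigma_algebra_preimage X A ->
        (\int[P]_(w in A) (G w)%:E = \int[P]_(w in A) (Y w)%:E)%E].

Definition cvg_in_probability (d : measure_display) (T : measurableType d)
  (R : realType) (P : probability T R) (u : nat -> T -> R) (c : R) : Prop :=
  forall e : R, 0 < e -> P [set w | e <= `|u n w - c|] @[n --> \oo] --> 0%E.

Definition Phi (R : realType) (x : R) : R := fine (normal_prob 0 1 `]-oo, x]).

(* 'pinv_ is a two-sided inverse here, as Phi is a bijection onto ]0, 1[;
   the default value 0 is not reached when 0 < a < 1. *)
Definition q (R : realType) (a : R) : R :=
  'pinv_(fun=> 0) setT (@Phi R) (1 - a / 2).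

Definition pick_freeze (R : realType) (n : nat) (y y' : 'I_n -> R) : R :=
  let m := n%:R^-1 * \sum_(i < n) (y i + y' i) / 2 in
  (n%:R^-1 * (\sum_(i < n) y i * y' i) - m ^+ 2) /
  (n%:R^-1 * (\sum_(i < n) (y i ^+ 2 + y' i ^+ 2) / 2) - m ^+ 2).

(* The statistic T of the pairs (f(x, z), f(x, z')) over a sample of (x, z, z'). *)
Definition pick_freeze_of (R : realType) (p1 p2 n : nat)
  (f : (p1 + p2).-tuple R -> R)
  (s : 'I_n -> p1.-tuple R * p2.-tuple R * p2.-tuple R) : R :=
  pick_freeze (fun i => f (concat (s i).1.1 (s i).1.2))
              (fun i => f (concat (s i).1.1 (s i).2)).

(* V_N for an N-sample s and a further n-sample t, with n = psi N. *)
Definition reduced_estimator (R : realType) (p1 p2 N n : nat)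
  (eta etac : (p1 + p2).-tuple R -> R)
  (s : 'I_N -> p1.-tuple R * p2.-tuple R * p2.-tuple R)
  (t : 'I_n -> p1.-tuple R * p2.-tuple R * p2.-tuple R) : R :=
  pick_freeze_of etac s + (pick_freeze_of eta t - pick_freeze_of etac t).

(* Main.v *)
Require Import Defs.
From HB Require Import structures.
From mathcomp Require Import all_boot all_order all_algebra.
From mathcomp Require Import all_classical all_reals all_analysis.
From mathcomp Require Import measurable_realfun ring lra.

(** Let u = Y - E Y, u' = Y' - E Y, and D = A - B / 2, that is
    D = u u' - S (u^2 + u'^2) / 2. The statistic does not change when a constant
    is added to all outputs, so it may be computed from the centred ones, and
    then T - S is the average of the D_i, up to a multiple of the square of the
    average of the (u_i + u'_i) / 2, divided by a denominator that tends to
    Var Y (pick_freeze_centered). D is centred: given X, the variables u and u'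
    are independent with the same law, so E(u u'|X) = E(u|X)^2 and
    E(u u') = Var E(Y|X) = S Var Y (variance_cond_exp). The square of an
    average of n centred variables is of order 1/n, so sqrt n (T - S) is a
    normalized sum of copies of D / Var Y up to a term that tends to 0 in
    probability (pick_freeze_linear, with the law of large numbers wlln). The
    two statistics of E_N use the same sample: the first-order term of
    E_N - (S - S_c) is the normalized sum of D / Var Y - D_c / Var Y_c, whose
    variance is sigma_e^2, and that of T_N - S_c has variance sigma_c^2.

    By the central limit theorem (clt) and Slutsky's theorem (confidence), each
    of |T_N - S_c| and |E_N - (S - S_c)| exceeds its part of the half-width with
    asymptotic probability at most alpha_c, respectively alpha_e. As S - V_N is
    minus the sum of the two errors, the union bound finishes the proof.

    The case sigma_c = 0 is different: D_c vanishes almost surely and T_N - S_c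
    could still be of order 1/N while the half-width allows 0. But D_c = 0 means
    u u' = S_c (u^2 + u'^2) / 2; given X, u and u' are independent with the same
    law, so they are nearly equal with positive probability, which is impossible
    unless S_c = 1 or u = 0 (degenerate_ratio). So S_c = 1, and then T_N = 1 as
    soon as its denominator is not 0 (pick_freeze_degenerate).

    The central limit theorem is proved by Stein's method. For a Lipschitz h with
    compact support and Gaussian mean 0, the solution phi of phi' - x phi = h
    has compact support too (stein_solution), and comparing a normalized sum
    with itself minus one summand bounds the mean of phi' - x phi at the sum
    (stein_bound). Finite variance suffices for this. *)

Set Implicit Arguments.
Unset Strict Implicit.
Unset Printing Implicit Defensive.

Import Order.TTheory GRing.Theory Num.Theory.
Import numFieldNormedType.Exports.

Local Open Scope classical_set_scope.
Local Open Scope ring_scope.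

(** * Integrable functions and their means *)
Definition itg d (T : measurableType d) (R : realType) (P : probability T R)
  (f : T -> R) := P.-integrable setT (EFin \o f).

Section expectation.
Context d (T : measurableType d) (R : realType) (P : probability T R).
Implicit Types f g : T -> R.

Lemma itg_meas f : itg P f -> measurable_fun setT f.
Proof. by move=> /measurable_int /measurable_EFinP. Qed.

Lemma eq_itg f g : itg P f -> f =1 g -> itg P g.
Proof. by move=> + /funext <-. Qed.

Lemma itg_le f g : measurable_fun setT f -> (forall w, `|f w| <= g w) ->
  itg P g -> itg P f.
Proof.
move=> mf fg; apply: le_integrable => //; first exact/measurable_EFinP.
move=> x _ /=; rewrite lee_fin (le_trans (fg x))// ler_norm//.
Qed.

Lemma itg_cst c : itg P (fun=> c).
Proof. exact: finite_measure_integrable_cst. Qed.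

Lemma itg_bounded f c : measurable_fun setT f -> (forall w, `|f w| <= c) ->
  itg P f.
Proof. by move=> mf fc; apply: itg_le mf fc (itg_cst c). Qed.

Lemma itgD f g : itg P f -> itg P g -> itg P (fun w => f w + g w).
Proof. by move=> fi gi; exact: (integrableD measurableT fi gi). Qed.

Lemma itgN f : itg P f -> itg P (fun w => - f w).
Proof. by move=> fi; exact: (integrableN fi). Qed.

Lemma itgB f g : itg P f -> itg P g -> itg P (fun w => f w - g w).
Proof. by move=> fi gi; apply: itgD => //; exact: itgN. Qed.

Lemma itgZ c f : itg P f -> itg P (fun w => c * f w).
Proof. by move=> fi; exact: (integrableZl measurableT c fi). Qed.

Lemma itg_norm f : itg P f -> itg P (fun w => `|f w|).
Proof. by move=> fi; exact: (integrable_norm fi). Qed.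

Lemma itg_sum n (f : 'I_n -> T -> R) : (forall i, itg P (f i)) ->
  itg P (fun w => \sum_(i < n) f i w).
Proof.
move=> fi; rewrite /itg.
rewrite (_ : _ \o _ = fun w => (\sum_(i < n) (f i w)%:E)%E); last first.
  by apply/funext => w /=; rewrite -sumEFin.
by apply: integrable_sum => // i _; exact: fi.
Qed.

Lemma meanD f g : itg P f -> itg P g ->
  \int[P]_w (f w + g w) = \int[P]_w f w + \int[P]_w g w.
Proof. by move=> fi gi; rewrite RintegralD. Qed.

Lemma meanB f g : itg P f -> itg P g ->
  \int[P]_w (f w - g w) = \int[P]_w f w - \int[P]_w g w.
Proof. by move=> fi gi; rewrite RintegralB. Qed.

Lemma meanZ c f : itg P f -> \int[P]_w (c * f w) = c * \int[P]_w f w.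
Proof. by move=> fi; rewrite RintegralZl. Qed.

Lemma mean_cst c : \int[P]_w c = c.
Proof. by rewrite /Rintegral integral_cst// [X in (_ * X)%E]probability_setT mule1. Qed.

Lemma mean_sum n (f : 'I_n -> T -> R) : (forall i, itg P (f i)) ->
  \int[P]_w (\sum_(i < n) f i w) = \sum_(i < n) \int[P]_w f i w.
Proof.
elim: n f => [|n IHn] f fi.
  by under eq_Rintegral do rewrite big_ord0; rewrite big_ord0 mean_cst.
under eq_Rintegral do rewrite big_ord_recl.
rewrite big_ord_recl meanD//; last by apply: itg_sum.
by rewrite IHn.
Qed.

Lemma mean_le f g : itg P f -> itg P g -> (forall w, f w <= g w) ->
  \int[P]_w f w <= \int[P]_w g w.
Proof. by move=> fi gi fg; apply: le_Rintegral => // w _; exact: fg. Qed.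

Lemma mean_ge0 f : (forall w, 0 <= f w) -> 0 <= \int[P]_w f w.
Proof. by move=> f0; apply: Rintegral_ge0. Qed.

Lemma mean_norm_le f g : measurable_fun setT f -> itg P g ->
  (forall w, `|f w| <= g w) -> `|\int[P]_w f w| <= \int[P]_w g w.
Proof.
move=> mf gi fg; have fi := itg_le mf fg gi.
apply: le_trans (le_normr_Rintegral measurableT fi) _.
by apply: mean_le => //; exact: itg_norm.
Qed.

Lemma mean_EFin f : itg P f -> (\int[P]_w (f w)%:E)%E = (\int[P]_w f w)%:E.
Proof. by move=> fi; rewrite /Rintegral fineK//; exact: integrable_fin_num. Qed.

(** The product is dominated by the sum of the squares. *)
Lemma itg_mul f g : measurable_fun setT f -> measurable_fun setT g ->
  itg P (fun w => f w ^+ 2) -> itg P (fun w => g w ^+ 2) ->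
  itg P (fun w => f w * g w).
Proof.
move=> mf mg f2 g2; apply: (itg_le _ _ (itgD f2 g2)); first exact: measurable_funM.
move=> w /=; rewrite normrM -(real_normK (num_real (f w))) -(real_normK (num_real (g w))).
have := sqr_ge0 (`|f w| - `|g w|).
by have := normr_ge0 (f w); have := normr_ge0 (g w); nra.
Qed.

Lemma itg_sqr f : measurable_fun setT f -> itg P (fun w => f w ^+ 2) -> itg P f.
Proof.
move=> mf f2.
have /eq_itg : itg P (fun w => f w * cst 1 w).
  by apply: itg_mul => //=; rewrite expr1n; exact: itg_cst.
by apply=> w; rewrite mulr1.
Qed.

(** The variance is nonnegative. *)
Lemma mean_sqr_le f : measurable_fun setT f -> itg P (fun w => f w ^+ 2) ->
  (\int[P]_w f w) ^+ 2 <= \int[P]_w (f w ^+ 2).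
Proof.
move=> mf f2; have fi := itg_sqr mf f2; set m := \int[P]_w f w.
have : 0 <= \int[P]_w ((f w ^+ 2 - (2 * m) * f w) + m ^+ 2).
  apply: mean_ge0 => w.
  by rewrite (_ : _ + _ = (f w - m) ^+ 2) ?sqr_ge0//; ring.
have fi' := itgZ (2 * m) fi.
rewrite meanD//; [|exact: itgB|exact: itg_cst].
by rewrite meanB// meanZ// mean_cst -/m; nra.
Qed.

Lemma markov_mean f (a : R) : itg P f -> (forall w, 0 <= f w) -> 0 < a ->
  measurable [set w | a <= f w] /\
  (P [set w | (a <= f w)%R] <= (a^-1 * \int[P]_w f w)%:E)%E.
Proof.
move=> fi f0 a0; have mf := itg_meas fi.
have mA : measurable [set w | a <= f w].
  rewrite -[X in measurable X]setTI.
  by apply: measurable_fun_le => //; exact: measurable_cst.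
split=> //.
rewrite EFinM -mean_EFin//.
have -> : P [set w | a <= f w] = (\int[P]_w (\1_[set w | a <= f w] w)%:E)%E.
  by rewrite integral_indic// setIT.
rewrite -integralZl//.
apply: ge0_le_integral => //.
- by apply/measurable_EFinP; exact: measurable_indic.
- by apply/measurable_EFinP; exact: measurable_funM.
- move=> w _ /=; rewrite lee_fin indicE; case: (boolP (w \in _)).
    by rewrite inE /= => h; rewrite mulrC ler_pdivlMr// mul1r.
  by move=> _; rewrite mulr_ge0// invr_ge0 ltW.
Qed.

(** Dominated convergence along integer levels. Every truncation below is at
    a fixed level given by this lemma, so that no moment beyond the assumed
    one is ever used. *)
Lemma mean_tail f (e : R) : itg P f -> (forall w, 0 <= f w) -> 0 < e ->
  exists2 K : R, 0 < K & \int[P]_w (f w * (K < f w)%R%:R) <= e.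
Proof.
move=> fi f0 e0; have mf := itg_meas fi.
pose F (n : nat) w := (f w * (n%:R < f w)%R%:R)%:E.
have mF n : measurable_fun setT (fun w => f w * (n%:R < f w)%R%:R).
  apply: measurable_funM => //.
  rewrite [X in measurable_fun _ X](_ : _ = \1_[set w | n%:R < f w]); last first.
    by apply/funext => w; rewrite indicE mem_setE.
  apply: measurable_indic.
  rewrite (_ : [set w | _] = ~` (setT `&` [set w | f w <= n%:R])); last first.
    by rewrite setTI; apply/seteqP; split=> w /=; rewrite ltNge => /negP.
  by apply/measurableC/measurable_fun_le => //; exact: measurable_cst.
have := @dominated_convergence _ _ _ P setT measurableT F (cst 0%E) (EFin \o f).
case.
- by move=> n; exact/measurable_EFinP.
- exact: measurable_cst.
- apply: aeW => w _; apply/fine_cvgP => /=; split; first exact: nearW.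
  apply: cvg_near_cst; near=> n; rewrite /F /= ltNge.
  suff -> : f w <= n%:R by rewrite mulr0.
  by near: n; exact: nbhs_infty_ger.
- exact: fi.
- apply: aeW => w n _; rewrite /F lee_fin ger0_norm ?mulr_ge0//.
  by rewrite ler_piMr// lern1 leq_b1.
move=> _ _; rewrite integral0 => /fine_cvgP[_ /cvgrPdist_le/(_ _ e0)].
move=> [N _ /(_ N.+1)] /= /(_ (leqnSn _)); rewrite sub0r normrN => h.
exists N.+1%:R => //; apply: le_trans (ler_norm _) _; exact: h.
Unshelve. all: by end_near. Qed.

End expectation.

(** * Laws and independence *)
Definition rv d d' (T : measurableType d) (U : measurableType d')
  (R : realType) (P : probability T R) (f : T -> U)
  (mf : measurable_fun setT f) : {RV P >-> U} :=
  HB.pack f (isMeasurableFun.Build _ _ _ _ f mf).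

Section image_law.
Context d dU (T : measurableType d) (U : measurableType dU) (R : realType)
  (P : probability T R).

Lemma mean_distribution (f : {RV P >-> U}) (F : U -> R) :
  measurable_fun setT F -> itg P (F \o f) ->
  (distribution P f).-integrable setT (EFin \o F) /\
  \int[distribution P f]_u F u = \int[P]_w F (f w).
Proof.
move=> mF iF; have mf : measurable_fun setT f by [].
split; last first.
  rewrite /Rintegral integral_distribution//; exact/measurable_EFinP.
by apply: integrable_pushforward => //; exact/measurable_EFinP.
Qed.

Lemma same_law_itg (f g : {RV P >-> U}) (F : U -> R) :
  same_law P f g -> measurable_fun setT F ->
  itg P (fun w => F (g w)) ->
  itg P (fun w => F (f w)) /\ \int[P]_w F (f w) = \int[P]_w F (g w).
Proof.
move=> fg mF iF.
have iFf : itg P (fun w => F (f w)).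
  apply/integrableP; split.
    by apply/measurable_EFinP; exact: measurableT_comp.
  have mnF : measurable_fun setT (fun u => `|(F u)%:E|%E).
    by apply: measurableT_comp => //; exact/measurable_EFinP.
  have := integrableP _ _ _ iF => -[_].
  have := @ge0_integral_distribution _ _ _ _ _ P f _ mnF (fun=> abse_ge0 _).
  have := @ge0_integral_distribution _ _ _ _ _ P g _ mnF (fun=> abse_ge0 _).
  move=> /= <- <-; apply: le_lt_trans.
  rewrite le_eqVlt; apply/orP; left; apply/eqP.
  by apply: eq_measure_integral => A mA _; exact: fg.
split=> //; rewrite -(mean_distribution mF iFf).2 -(mean_distribution mF iF).2.
congr fine; apply: eq_measure_integral => A mA _; exact: fg.
Qed.

End image_law.

Section joint_law.
Context d dU dV (T : measurableType d) (U : measurableType dU)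
  (V : measurableType dV) (R : realType) (P : probability T R).
Variables (f : {RV P >-> U}) (g : {RV P >-> V}).
Hypothesis fg : independent2 P f g.

Let mfg : measurable_fun setT (fun w => (f w, g w)).
Proof. exact: measurable_fun_pair. Qed.

(** A measure on the product is determined by its values on rectangles. *)
Lemma joint_law C : measurable C ->
  (distribution P f \x distribution P g)%E C =
  P ((fun w => (f w, g w)) @^-1` C).
Proof.
move=> mC; rewrite -[RHS]/(distribution P (rv P mfg) C).
by apply: product_measure_unique => // A B mA mB; exact: fg.
Qed.

Lemma mean_joint (F : U * V -> R) : measurable_fun setT F ->
  itg P (fun w => F (f w, g w)) ->
  (distribution P f \x distribution P g)%E.-integrable setT (EFin \o F) /\
  (\int[P]_w F (f w, g w))%:E =
  (\int[distribution P f]_x \int[distribution P g]_y (F (x, y))%:E)%E.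
Proof.
move=> mF iF.
have [i1 e1] := @mean_distribution _ _ _ _ _ P (rv P mfg) F mF iF.
have i2 : (distribution P f \x distribution P g)%E.-integrable setT (EFin \o F).
  have /integrableP[mF' ilt] := i1; apply/integrableP; split => //.
  apply: le_lt_trans ilt; rewrite le_eqVlt; apply/orP; left; apply/eqP.
  by apply: eq_measure_integral => A mA _; exact: joint_law.
split=> //; rewrite [RHS](integral12_prod_meas1 i2).
rewrite -e1 /= /Rintegral fineK; last exact: integrable_fin_num.
by apply: eq_measure_integral => A mA _; apply/esym; exact: joint_law.
Qed.

End joint_law.

(** Tonelli gives the integrability of the product, and Fubini its mean. *)
Lemma mean_indep d (T : measurableType d) (R : realType) (P : probability T R)
  (f g : T -> R) : independent2 P f g -> itg P f -> itg P g ->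
  itg P (fun w => f w * g w) /\
  \int[P]_w (f w * g w) = \int[P]_w f w * \int[P]_w g w.
Proof.
move=> fg fi gi; have mf := itg_meas fi; have mg := itg_meas gi.
pose F := rv P mf; pose G := rv P mg.
have mM : measurable_fun setT (fun z : R * R => z.1 * z.2).
  exact: measurable_funM.
have [iF eF] := @mean_distribution _ _ _ _ _ P F id (@measurable_id _ _ _) fi.
have [iG eG] := @mean_distribution _ _ _ _ _ P G id (@measurable_id _ _ _) gi.
have FG : independent2 P F G by [].
have mfg : measurable_fun setT (fun w => (F w, G w)).
  exact: measurable_fun_pair.
have Eabs x : (\int[distribution P G]_y `|(x * y)%:E| =
    `|x|%:E * \int[distribution P G]_y `|y|%:E)%E.
  under eq_integral do rewrite /= normrM EFinM.
  rewrite ge0_integralZl//; apply/measurable_EFinP; exact: normr_measurable.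
have E x : (\int[distribution P G]_y (x * y)%:E =
    x%:E * (\int[P]_w g w)%R%:E)%E.
  under eq_integral do rewrite EFinM.
  by rewrite integralZl// mean_EFin// eG.
have ifg : itg P (fun w => f w * g w).
  have : ((distribution P F \x distribution P G)%E).-integrable setT
     (fun z => (z.1 * z.2)%:E).
    apply/integrable12ltyP; first exact/measurable_EFinP.
    under eq_integral do rewrite Eabs.
    rewrite ge0_integralZr//; last 2 first.
    - by apply/measurable_EFinP; exact: normr_measurable.
    - by apply: integral_ge0.
    apply: lte_mul_pinfty.
    + exact: integral_ge0.
    + by rewrite ge0_fin_numE ?integral_ge0//; case/integrableP: iF.
    + by case/integrableP: iG.
  move=> /integrableP[m1 lt1]; apply/integrableP; split.
    by apply/measurable_EFinP; exact: measurable_funM.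
  apply: le_lt_trans lt1.
  have := @ge0_integral_distribution _ _ _ _ _ P (rv P mfg)
    (fun z => `|(z.1 * z.2)%:E|%E) _ (fun=> abse_ge0 _).
  have m2 : measurable_fun setT (fun z : R * R => `|(z.1 * z.2)%:E|%E).
    exact: measurableT_comp.
  move=> /(_ m2) /= <-.
  rewrite le_eqVlt; apply/orP; left; apply/eqP.
  by apply: eq_measure_integral => A mA _; apply/esym; exact: joint_law.
split=> //; apply/EFin_inj.
rewrite (mean_joint FG mM ifg).2 /=.
under eq_integral do rewrite E.
by rewrite integralZr// mean_EFin// eF.
Qed.

(** * Rows of independent copies *)
(** Boxes are stable under intersection and generate the sigma-algebra of
    the tuples, so two finite measures that agree on them are equal. *)
Definition box (R : realType) n : set_system (n.-tuple R) :=
  [set C | exists2 B : 'I_n -> set R, (forall j, measurable (B j)) &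
    C = [set t | forall j, B j (tnth t j)]].

Lemma measurable_box (R : realType) n (B : 'I_n -> set R) :
  (forall j, measurable (B j)) ->
  measurable [set t : n.-tuple R | forall j, B j (tnth t j)].
Proof.
move=> mB.
rewrite (_ : [set _ | _] =
  \big[setI/setT]_(j < n) ((fun t : n.-tuple R => tnth t j) @^-1` B j)).
  apply: bigsetI_measurable => j _; rewrite -[X in measurable X]setTI.
  exact: measurable_tnth.
rewrite -bigcap_seq; apply/seteqP; split=> t /= Bt j; first by move=> _; exact: Bt.
by apply: Bt => /=; rewrite mem_index_enum.
Qed.

Lemma box_generates (R : realType) n :
  @measurable _ (n.-tuple R) = <<s @box R n >>.
Proof.
apply/seteqP; split.
- apply: smallest_sub; first exact: smallest_sigma_algebra.
  rewrite -bigcup_seq => C [i _ [A mA <-]].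
  apply: sub_sigma_algebra => /=.
  exists (fun j => if j == i then A else setT) => [j|]; first by case: ifP.
  rewrite setTI; apply/seteqP; split=> t /= => [At j|/(_ i)]; last by rewrite eqxx.
  by case: eqP => // ->.
- apply: smallest_sub; first exact: sigma_algebra_measurable.
  by move=> C [B mB ->]; exact: measurable_box.
Qed.

Lemma box_setI (R : realType) n : setI_closed (@box R n).
Proof.
move=> _ _ [B mB ->] [C mC ->].
exists (fun j => B j `&` C j) => [j|]; first exact: measurableI.
apply/seteqP; split=> t /=; first by move=> [hB hC] j; split.
by move=> h; split=> j; case: (h j).
Qed.

Section rows.
Context d dU (T : measurableType d) (U : measurableType dU) (R : realType)
  (P : probability T R) (n : nat).
Variables (xi : 'I_n -> {RV P >-> U}) (W : {RV P >-> U}).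
Hypothesis iid : iid_copies P (fun i => xi i : T -> U) W.

Lemma row_transfer i (h : U -> R) : measurable_fun setT h ->
  itg P (fun w => h (W w)) ->
  itg P (fun w => h (xi i w)) /\ \int[P]_w h (xi i w) = \int[P]_w h (W w).
Proof. by move=> mh; apply: same_law_itg => //; exact: iid.2. Qed.

(** All the copies but the i-th; the constant 0 at position i keeps the length
    equal to n, so that the measurable structure of n-tuples applies. *)
Definition others (i : 'I_n) (k : U -> R) w : n.-tuple R :=
  [tuple (if j == i then 0 else k (xi j w)) | j < n].

Lemma measurable_others i k : measurable_fun setT k ->
  measurable_fun setT (others i k).
Proof.
move=> mk; apply/measurable_fun_tnthP => j /=.
rewrite (_ : _ \o _ = fun w => if j == i then 0 else k (xi j w)); last first.
  by apply/funext => w /=; rewrite /others tnth_mktuple.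
by case: eqP => _; [exact: measurable_cst|exact: measurableT_comp].
Qed.

(** For fixed A, the two sides are finite measures in C, and mutual
    independence says that they agree on the boxes. *)
Lemma indep_others i k : measurable_fun setT k ->
  independent2 P (xi i) (others i k).
Proof.
move=> mk A C mA mC.
have mxA : measurable (xi i @^-1` A) by exact: measurable_funPTI.
pose Z := rv P (measurable_others i mk).
have [p pE] : exists p : {nonneg R}, (p%:num)%:E = P (xi i @^-1` A).
  exists (NngNum (fine_ge0 (measure_ge0 P (xi i @^-1` A)))).
  by rewrite /= fineK// fin_num_measure.
pose m1 := pushforward (mrestr P mxA) Z.
pose m2 := mscale p (distribution P Z).
suff : m1 C = m2 C.
  by rewrite /m1 /m2 /pushforward /mrestr /mscale setIC pE => ->.
apply: (@measure_unique _ _ _ (@box R n) (fun=> setT)) => //.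
- exact: box_generates.
- exact: box_setI.
- move=> _; exists (fun=> setT) => //.
  by apply/seteqP; split.
- by apply/seteqP; split => // x _; exists 0%N.
- move=> _ [B mB ->].
  rewrite -[LHS]/(P (Z @^-1` _ `&` _)) -[RHS]/(p%:num%:E * P (Z @^-1` _))%E pE.
  (* The i-th side of the box sees the constant 0 only. *)
  have [B0|B0] := pselect (B i 0); last first.
    rewrite (_ : Z @^-1` _ = set0) ?set0I ?measure0 ?mule0//.
    by rewrite -subset0 => w /= /(_ i); rewrite tnth_mktuple eqxx.
  pose F j := if j == i then A else k @^-1` B j.
  pose F' j := if j == i then setT else k @^-1` B j.
  have mkB j : measurable (k @^-1` B j).
    by rewrite -[X in measurable X]setTI; exact: (mk measurableT).
  have mF j : measurable (F j) by rewrite /F; case: eqP.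
  have mF' j : measurable (F' j) by rewrite /F'; case: eqP.
  have -> : Z @^-1` [set t | forall j, B j (tnth t j)] `&` xi i @^-1` A =
     \bigcap_(j in [set: 'I_n]) xi j @^-1` F j.
    apply/seteqP; split=> w /=.
      move=> [hB hA] j _; rewrite /F /=; case: eqP => [->//|/eqP ji].
      by have := hB j; rewrite tnth_mktuple (negbTE ji).
    move=> h; split; last by have := h i I; rewrite /F eqxx.
    move=> j; rewrite tnth_mktuple; case: eqP => [->//|/eqP ji].
    by have := h j I; rewrite /F (negbTE ji).
  have -> : Z @^-1` [set t | forall j, B j (tnth t j)] =
     \bigcap_(j in [set: 'I_n]) xi j @^-1` F' j.
    apply/seteqP; split=> w /=.
      move=> hB j _; rewrite /F' /=; case: eqP => [->//|/eqP ji].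
      by have := hB j; rewrite tnth_mktuple (negbTE ji).
    move=> h j; rewrite tnth_mktuple; case: eqP => [->//|/eqP ji].
    by have := h j I; rewrite /F' (negbTE ji).
  rewrite (iid.1 _ mF) (iid.1 _ mF') (bigD1 i)//= [in RHS](bigD1 i)//=.
  rewrite /F /F' eqxx preimage_setT [X in (_ * (X * _))%E]probability_setT mul1e.
  by congr (_ * _)%E; apply: eq_bigr => j /negbTE ->.
- move=> _; rewrite -[X in (X < _)%E]/(P (Z @^-1` setT `&` xi i @^-1` A)).
  rewrite preimage_setT setTI.
  by apply: (le_lt_trans (probability_le1 P mxA)); rewrite ltry.
Qed.

Lemma indep_pair i j (h k : U -> R) : i != j ->
  measurable_fun setT h -> measurable_fun setT k ->
  independent2 P (fun w => h (xi i w)) (fun w => k (xi j w)).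
Proof.
move=> ij mh mk A B mA mB.
have := indep_others i mk (mh measurableT _ mA)
  (@measurable_tnth _ _ _ j measurableT _ mB).
rewrite !setTI.
rewrite (_ : others i k @^-1` _ = (fun w => k (xi j w)) @^-1` B)//.
by apply/seteqP; split=> w /=; rewrite tnth_mktuple eq_sym (negbTE ij).
Qed.

Lemma indep_rest i (h k : U -> R) (phi : R -> R) :
  measurable_fun setT h -> measurable_fun setT k -> measurable_fun setT phi ->
  independent2 P (fun w => h (xi i w))
    (fun w => phi (\sum_(j < n | j != i) k (xi j w))).
Proof.
move=> mh mk mphi A B mA mB.
have msum : measurable_fun setT
    (fun t : n.-tuple R => phi (\sum_(j < n | j != i) tnth t j)).
  apply: measurableT_comp => //; under eq_fun do rewrite big_mkcond.
  apply: measurable_sum => j; case: (j != i); last exact: measurable_cst.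
  exact: measurable_tnth.
have := indep_others i mk (mh measurableT _ mA) (msum measurableT _ mB).
rewrite !setTI.
rewrite (_ : others i k @^-1` _ =
    (fun w => phi (\sum_(j < n | j != i) k (xi j w))) @^-1` B)//.
have E w : \sum_(j < n | j != i) tnth (others i k w) j =
    \sum_(j < n | j != i) k (xi j w).
  by apply: eq_bigr => j /negbTE ji; rewrite tnth_mktuple ji.
by apply/seteqP; split=> w /=; rewrite E.
Qed.

(** Distinct centred copies are uncorrelated. *)
Lemma row_sum_sqr (h : U -> R) : measurable_fun setT h ->
  itg P (fun w => h (W w) ^+ 2) -> \int[P]_w h (W w) = 0 ->
  itg P (fun w => (\sum_(i < n) h (xi i w)) ^+ 2) /\
  \int[P]_w ((\sum_(i < n) h (xi i w)) ^+ 2) = n%:R * \int[P]_w (h (W w) ^+ 2).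
Proof.
move=> mh h2 h0.
have mhW : measurable_fun setT (fun w => h (W w)) by exact: measurableT_comp.
have hW := itg_sqr mhW h2.
have mh2 : measurable_fun setT (fun u => h u ^+ 2) by exact: measurable_funX.
have ih i j : itg P (fun w => h (xi i w) * h (xi j w)) /\
    \int[P]_w (h (xi i w) * h (xi j w)) =
    if i == j then \int[P]_w (h (W w) ^+ 2) else 0.
  have [<-|ij] := eqVneq i j; first by exact: (row_transfer i mh2 h2).
  have [ii ei] := row_transfer i mh hW; have [ij' ej] := row_transfer j mh hW.
  have [ip ->] := mean_indep (indep_pair ij mh mh) ii ij'.
  by rewrite ei h0 mul0r.
have sE w : (\sum_(i < n) h (xi i w)) ^+ 2 =
    \sum_(i < n) \sum_(j < n) h (xi i w) * h (xi j w).
  by rewrite expr2 mulr_suml; apply: eq_bigr => i _; rewrite mulr_sumr.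
have is_ i : itg P (fun w => \sum_(j < n) h (xi i w) * h (xi j w)).
  by apply: itg_sum => j; exact: (ih i j).1.
split; first by apply: eq_itg (itg_sum is_) _ => w; rewrite sE.
under eq_Rintegral do rewrite sE.
rewrite mean_sum// mulr_natl -[n in RHS]card_ord -sumr_const.
apply: eq_bigr => i _; rewrite mean_sum; last by move=> j; exact: (ih i j).1.
rewrite (bigD1 i)//= (ih i i).2 eqxx big1 ?addr0// => j ji.
by rewrite (ih i j).2 eq_sym (negbTE ji).
Qed.

End rows.

(** * Probabilities in the limit *)
Section asymptotic_probability.
Context d (T : measurableType d) (R : realType) (P : probability T R).
Implicit Types (E F : nat -> set T) (a b c : R) (u v : nat -> T -> R).

(** The limsup of the outer probability of E N is at most a. Outer
    probability lets events be enlarged, cut and united without a proof that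
    each of them is measurable. *)
Definition asymp_le E a := forall e : R, 0 < e -> \forall N \near \oo,
  exists2 B,
    measurable B & E N `<=` B /\ (P B <= (a + e)%:E)%E.

Lemma asymp_le_near E F a : (\forall N \near \oo, E N `<=` F N) ->
  asymp_le F a -> asymp_le E a.
Proof.
move=> EF Fa e e0; near=> N.
have [B mB [FB PB]] : exists2 B,
    measurable B & F N `<=` B /\ (P B <= (a + e)%:E)%E.
  by near: N; exact: Fa.
by exists B => //; split=> //; apply: subset_trans FB; near: N.
Unshelve. all: by end_near. Qed.

Lemma asymp_le_sub E F a : (forall N, E N `<=` F N) ->
  asymp_le F a -> asymp_le E a.
Proof. by move=> EF; apply: asymp_le_near; exact: nearW. Qed.

(** The union bound; the error probabilities of the theorem are added here. *)
Lemma asymp_leU E F a b : asymp_le E a -> asymp_le F b ->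
  asymp_le (fun N => E N `|` F N) (a + b).
Proof.
move=> Ea Fb e e0; have e20 : 0 < e / 2 by rewrite divr_gt0.
near=> N.
have [B mB [EB PB]] : exists2 B,
    measurable B & E N `<=` B /\ (P B <= (a + e / 2)%:E)%E.
  by near: N; exact: Ea.
have [C mC [FC PC]] : exists2 B,
    measurable B & F N `<=` B /\ (P B <= (b + e / 2)%:E)%E.
  by near: N; exact: Fb.
exists (B `|` C); first exact: measurableU.
split; first exact: setUSS.
apply: (le_trans (measureU2 _ mB mC)).
rewrite (_ : a + b + e = (a + e / 2) + (b + e / 2)); last by field.
by rewrite EFinD leeD.
Unshelve. all: by end_near. Qed.

Lemma asymp_leU0 E F a : asymp_le E a -> asymp_le F 0 ->
  asymp_le (fun N => E N `|` F N) a.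
Proof. by move=> Ea F0; rewrite -[a]addr0; exact: asymp_leU. Qed.

Lemma asymp_le_lim E a : (forall e, 0 < e -> asymp_le E (a + e)) -> asymp_le E a.
Proof.
move=> H e e0; have e20 : 0 < e / 2 by rewrite divr_gt0.
near=> N.
have [B mB [EB PB]] : exists2 B,
    measurable B & E N `<=` B /\ (P B <= (a + e / 2 + e / 2)%:E)%E.
  by near: N; exact: H.
by exists B => //; split=> //; rewrite [e]splitr addrA.
Unshelve. all: by end_near. Qed.

Lemma asymp_le_ge E a b : a <= b -> asymp_le E a -> asymp_le E b.
Proof.
move=> ab Ea e e0; near=> N.
have [B mB [EB PB]] : exists2 B,
    measurable B & E N `<=` B /\ (P B <= (a + e)%:E)%E.
  by near: N; exact: Ea.
by exists B => //; split=> //; apply: (le_trans PB); rewrite lee_fin lerD2r.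
Unshelve. all: by end_near. Qed.

Lemma asymp_le_markov (f : nat -> T -> R) c a : 0 < c ->
  (\forall N \near \oo, (forall w, 0 <= f N w) /\ itg P (f N)) ->
  (forall e, 0 < e -> \forall N \near \oo, \int[P]_w f N w <= a + e) ->
  asymp_le (fun N => [set w | c <= f N w]) (c^-1 * a).
Proof.
move=> c0 Hf Ha e e0; have {}Ha := Ha _ (mulr_gt0 c0 e0); near=> N.
have [fge0 fi] : (forall w, 0 <= f N w) /\ itg P (f N) by near: N.
have [mB PB] := markov_mean fi fge0 c0.
exists [set w | c <= f N w] => //; split=> //.
apply: (le_trans PB); rewrite lee_fin.
have h : \int[P]_w f N w <= a + c * e by near: N.
rewrite (_ : c^-1 * a + e = c^-1 * (a + c * e)); last by field; rewrite gt_eqF.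
by rewrite ler_wpM2l// invr_ge0 ltW.
Unshelve. all: by end_near. Qed.

(** Convergence in probability, in terms of outer probability. *)
Definition to_prob u c :=
  forall e, 0 < e -> asymp_le (fun N => [set w | e <= `|u N w - c|]) 0.

Definition tight u :=
  forall e, 0 < e -> exists2 K, 0 < K & asymp_le (fun N => [set w | K <= `|u N w|]) e.

Lemma to_prob_near u v c : (\forall N \near \oo, forall w, u N w = v N w) ->
  to_prob u c -> to_prob v c.
Proof.
move=> uv uc e e0; apply: asymp_le_near (uc e e0).
by apply: filterS uv => N uv w /=; rewrite uv.
Qed.

Lemma to_probD u v a b : to_prob u a -> to_prob v b ->
  to_prob (fun N w => u N w + v N w) (a + b).
Proof.
move=> ua vb e e0; have e20 : 0 < e / 2 by rewrite divr_gt0.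
apply: asymp_le_sub (asymp_leU0 (ua _ e20) (vb _ e20)) => N w /=.
apply: contraPP => /not_orP[/negP + /negP]; rewrite -!ltNge => h1 h2.
apply/negP; rewrite -ltNge [e]splitr opprD addrACA.
by apply: le_lt_trans (ler_normD _ _) _; exact: ltrD.
Qed.

Lemma to_prob_cst c : to_prob (fun _ _ => c) c.
Proof.
move=> e e0 e' e'0; near=> N; exists set0 => //; split.
  by move=> w /=; rewrite subrr normr0 leNgt e0.
by rewrite measure0 lee_fin add0r ltW.
Unshelve. all: by end_near. Qed.

Lemma tight_mul0 u v : tight u -> to_prob v 0 ->
  to_prob (fun N w => u N w * v N w) 0.
Proof.
move=> tu v0 e e0; apply: asymp_le_lim => t t0; rewrite add0r.
have [K K0 uK] := tu _ t0.
have eK : 0 < e / K by rewrite divr_gt0.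
apply: asymp_le_sub (asymp_leU0 uK (v0 _ eK)) => N w /=.
rewrite !subr0; apply: contraPP => /not_orP[/negP + /negP].
rewrite -!ltNge => h1 h2; apply/negP; rewrite -ltNge normrM.
have -> : e = K * (e / K) by rewrite mulrC divfK ?gt_eqF.
exact: ltr_pM.
Qed.

Lemma to_prob_tight u c : to_prob u c -> tight u.
Proof.
move=> uc t t0; exists (`|c| + 1); first by rewrite ltr_wpDl.
apply: asymp_le_ge (ltW t0) _.
apply: asymp_le_sub (uc _ ltr01) => N w /=.
rewrite -lerBrDl => /le_trans; apply.
by rewrite lerBlDr ; apply: le_trans (ler_normD _ _); rewrite subrK.
Qed.

Lemma to_probZ u c a : to_prob u c -> to_prob (fun N w => a * u N w) (a * c).
Proof.
move=> uc e e0.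
have e1 : 0 < e / (`|a| + 1) by rewrite divr_gt0// ltr_wpDl.
apply: asymp_le_sub (uc _ e1) => N w /=.
rewrite -mulrBr normrM ler_pdivrMr ?ltr_wpDl// => /le_trans; apply.
by rewrite mulrC ler_wpM2l// lerDl.
Qed.

Lemma to_prob_inv u c : c != 0 -> to_prob u c ->
  to_prob (fun N w => (u N w)^-1) c^-1.
Proof.
move=> c0 uc e e0; have nc0 : 0 < `|c| by rewrite normr_gt0.
pose d0 := Num.min (`|c| / 2) (e * `|c| ^+ 2 / 2).
have d00 : 0 < d0 by rewrite lt_min !divr_gt0// mulr_gt0// exprn_gt0.
apply: asymp_le_sub (uc _ d00) => N w /=.
set x := u N w; rewrite leNgt; apply: contraNP; move/negP; rewrite -ltNge.
rewrite lt_min => /andP[h1 h2].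
have hx : `|c| / 2 < `|x|.
  have : `|c| <= `|x - c| + `|x| by rewrite distrC -{1}(subrK x c); exact: ler_normD.
  by lra.
have x0 : x != 0 by rewrite -normr_gt0; lra.
have -> : x^-1 - c^-1 = (c - x) / (x * c) by field; rewrite x0 c0.
rewrite normrM normfV normrM distrC ltr_pdivrMr ?mulr_gt0 ?normr_gt0//.
apply: lt_le_trans h2 _.
rewrite (_ : _ / 2 = e * (`|c| / 2 * `|c|)); last by field.
by rewrite ler_wpM2l ?ler_wpM2r// ltW.
Qed.

(** Markov's inequality for the square. *)
Lemma tight_L2 u C : (\forall N \near \oo, itg P (fun w => u N w ^+ 2) /\
    \int[P]_w (u N w ^+ 2) <= C) -> tight u.
Proof.
move=> H t t0; pose C' := `|C| + 1.
have C'0 : 0 < C' by rewrite ltr_wpDl.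
pose K2 := C' / t; have K20 : 0 < K2 by rewrite divr_gt0.
exists (Num.sqrt K2); first by rewrite sqrtr_gt0.
rewrite (_ : t = K2^-1 * C'); last by rewrite /K2 invf_div divfK ?gt_eqF.
apply: asymp_le_sub (asymp_le_markov (f := fun N w => u N w ^+ 2) K20 _ _).
- move=> N w /=; rewrite -(@ler_pXn2r _ 2)// ?nnegrE ?sqrtr_ge0//.
  by rewrite sqr_sqrtr ?[_ <= K2]ltW// (real_normK (num_real _)).
- apply: filterS H => N [h _]; split=> // w; exact: sqr_ge0.
- move=> e e0; apply: filterS H => N [_ h].
  by apply: (le_trans h); rewrite /C' (le_trans (ler_norm _))// -addrA lerDl addr_ge0// ltW.
Qed.

End asymptotic_probability.

Section asymptotic_rows.
Context d dU (T : measurableType d) (U : measurableType dU) (R : realType)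
  (P : probability T R) (n : nat -> nat).
Variables (xi : forall N, 'I_(n N) -> {RV P >-> U}) (W : {RV P >-> U}).
Arguments xi : clear implicits.
Hypothesis iid : forall N, iid_copies P (fun i => xi N i : T -> U) W.
Hypothesis noo : n N @[N --> \oo] --> \oo.

Lemma near_n (Q : nat -> Prop) : (\forall k \near \oo, Q k) ->
  \forall N \near \oo, Q (n N).
Proof. by move=> H; exact: (noo H). Qed.

Lemma n_inv_le (C e : R) : 0 < e -> \forall k \near \oo, k%:R^-1 * C <= e.
Proof.
move=> e0.
have H : (fun k : nat => k%:R^-1 * C : R) @ \oo --> (0 * C : R).
  apply: cvgMl; apply/gtr0_cvgV0; last exact: cvgr_idn.
  by exists 1%N => // k /=; rewrite ltr0n.
have /cvgrPdist_le/(_ _ e0) := H; apply: filterS => N.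
by rewrite mul0r sub0r normrN; apply: le_trans; exact: ler_norm.
Qed.

Lemma average_mean (h : U -> R) N : (0 < n N)%N -> measurable_fun setT h ->
  itg P (fun w => h (W w)) ->
  itg P (fun w => (n N)%:R^-1 * \sum_(i < n N) h (xi N i w)) /\
  \int[P]_w ((n N)%:R^-1 * \sum_(i < n N) h (xi N i w)) = \int[P]_w h (W w).
Proof.
move=> n0 mh hi; have H i := row_transfer (iid N) i mh hi.
have is_ : itg P (fun w => \sum_(i < n N) h (xi N i w)).
  by apply: itg_sum => i; exact: (H i).1.
split; first exact: itgZ.
rewrite meanZ// mean_sum; last by move=> i; exact: (H i).1.
under eq_bigr do rewrite (H _).2.
rewrite sumr_const card_ord -[X in _ * X]mulr_natl mulrA mulVf ?mul1r//.
by rewrite pnatr_eq0 -lt0n.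
Qed.

Lemma average_mean_sqr (h : U -> R) N : (0 < n N)%N -> measurable_fun setT h ->
  itg P (fun w => h (W w) ^+ 2) -> \int[P]_w h (W w) = 0 ->
  itg P (fun w => ((n N)%:R^-1 * \sum_(i < n N) h (xi N i w)) ^+ 2) /\
  \int[P]_w (((n N)%:R^-1 * \sum_(i < n N) h (xi N i w)) ^+ 2) =
  (n N)%:R^-1 * \int[P]_w (h (W w) ^+ 2).
Proof.
move=> n0 mh hi h0; have [i e] := row_sum_sqr (iid N) mh hi h0.
have n0' : (n N)%:R != 0 :> R by rewrite pnatr_eq0 -lt0n.
split.
  by apply: (eq_itg (itgZ ((n N)%:R^-1 ^+ 2) i)) => w; rewrite exprMn.
under eq_Rintegral do rewrite exprMn.
by rewrite meanZ// e; field.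
Qed.

(** The law of large numbers for a function that is only integrable: the
    squares averaged in the denominator of the statistic need not have a
    second moment. Below the truncation level K the variance of the average is of
    order 1/n; the part above has a small mean absolute value by mean_tail. *)
Lemma wlln (h : U -> R) : measurable_fun setT h -> itg P (fun w => h (W w)) ->
  to_prob P (fun N w => (n N)%:R^-1 * \sum_(i < n N) h (xi N i w))
    (\int[P]_w h (W w)).
Proof.
move=> mh hi e e0; apply: asymp_le_lim => t t0.
have e30 : 0 < e / 3 by rewrite divr_gt0.
pose tau := Num.min (e / 6) (e / 3 * t).
have tau0 : 0 < tau by rewrite lt_min divr_gt0// mulr_gt0.
have [K K0 HK] := mean_tail (itg_norm hi) (fun w => normr_ge0 (h (W w))) tau0.
pose b u : R := (K < `|h u|)%R%:R.
have mb : measurable_fun setT b.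
  rewrite (_ : b = \1_(~` [set u | `|h u| <= K])); last first.
    by apply/funext => u; rewrite indicE /b ltNge in_setC mem_setE.
  apply: measurable_indic; apply: measurableC.
  rewrite -[X in measurable X]setTI; apply: measurable_fun_le => //.
  exact: measurableT_comp.
have b01 u : 0 <= b u <= 1 by rewrite ler0n lern1 leq_b1.
pose hr u := h u * b u; pose ht u := h u * (1 - b u).
have mhr : measurable_fun setT hr by exact: measurable_funM.
have mht : measurable_fun setT ht.
  by apply: measurable_funM => //; exact: measurable_funB.
have htK u : `|ht u| <= K.
  rewrite normrM /b; case: ltP => /= hK; first by rewrite subrr normr0 mulr0 ltW.
  by rewrite subr0 normr1 mulr1.
have iht : itg P (fun w => ht (W w)).
  by apply: (@itg_bounded _ _ _ _ _ (K)) => //; exact: measurableT_comp.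
have ihr : itg P (fun w => hr (W w)).
  apply: (itg_le _ _ (itg_norm hi)); first exact: measurableT_comp.
  move=> w; rewrite /hr normrM ler_piMr// ger0_norm; by have /andP[] := b01 (W w).
have hE u : h u = ht u + hr u by rewrite /ht /hr; ring.
set mu := \int[P]_w h (W w); pose mt := \int[P]_w ht (W w).
pose mr := \int[P]_w hr (W w).
have muE : mu = mt + mr by rewrite -meanD//; apply: eq_Rintegral => w _; exact: hE.
have ihra : itg P (fun w => `|hr (W w)|) by exact: itg_norm.
have hra : \int[P]_w `|hr (W w)| <= tau.
  apply: le_trans HK; rewrite le_eqVlt; apply/orP; left; apply/eqP.
  by apply: eq_Rintegral => w _; rewrite /hr normrM /b [X in _ * X]ger0_norm.
have mrle : `|mr| <= e / 6.
  apply: le_trans (mean_norm_le (itg_meas ihr) ihra (fun=> lexx _)) _.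
  by apply: le_trans hra _; rewrite ge_min lexx.
pose g u := ht u - mt.
have mg : measurable_fun setT g by apply: measurable_funB => //; exact: measurable_cst.
have g2 : itg P (fun w => g (W w) ^+ 2).
  apply: (@itg_bounded _ _ _ _ _ ((K + `|mt|) ^+ 2)).
    by apply: measurable_funX; exact: measurableT_comp.
  move=> w; rewrite normrX ler_pXn2r ?nnegrE ?addr_ge0 ?(ltW K0)//.
  by apply: le_trans (ler_normB _ _) _; rewrite lerD2r.
have g0 : \int[P]_w g (W w) = 0.
  by rewrite meanB//; [rewrite mean_cst subrr|exact: itg_cst].
have n_gt0 : \forall N \near \oo, (0 < n N)%N.
  by apply: (near_n (Q := fun k => (0 < k)%N)); exists 1%N.
have E1 : asymp_le P (fun N => [set w | (e / 3) ^+ 2 <=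
    ((n N)%:R^-1 * \sum_(i < n N) g (xi N i w)) ^+ 2]) 0.
  apply: (@asymp_le_ge _ _ _ _ _ (((e / 3) ^+ 2)^-1 * 0)); first by rewrite mulr0.
  apply: asymp_le_markov.
  - by rewrite exprn_gt0.
  - apply: filterS n_gt0 => N n0; split; first by move=> w; exact: sqr_ge0.
    exact: (average_mean_sqr n0 mg g2 g0).1.
  - move=> r r0; near=> N.
    rewrite (average_mean_sqr _ mg g2 g0).2; last by near: N.
    rewrite add0r; near: N.
    by apply: (near_n (Q := fun k => k%:R^-1 * _ <= r)); exact: n_inv_le.
have mhra : measurable_fun setT (fun u => `|hr u|) by exact: measurableT_comp.
have E2 : asymp_le P (fun N => [set w | e / 3 <=
    (n N)%:R^-1 * \sum_(i < n N) `|hr (xi N i w)|]) ((e / 3)^-1 * tau).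
  apply: asymp_le_markov => //.
  - apply: filterS n_gt0 => N n0; split=> [w|].
      by rewrite mulr_ge0 ?invr_ge0 ?sumr_ge0.
    exact: (average_mean n0 mhra ihra).1.
  - move=> r r0; apply: filterS n_gt0 => N n0.
    rewrite (average_mean n0 mhra ihra).2; apply: (le_trans hra).
    by rewrite lerDl ltW.
have tauE : (e / 3)^-1 * tau <= t.
  by rewrite mulrC ler_pdivrMr// mulrC ge_min lexx orbT.
rewrite add0r -[t]addr0.
have := asymp_leU0 (asymp_le_ge tauE E2) E1.
rewrite addr0; apply: asymp_le_near; near=> N => w /=.
have n0 : (n N)%:R != 0 :> R by rewrite pnatr_eq0 -lt0n; near: N.
set Ag := (n N)%:R^-1 * \sum_(i < n N) g (xi N i w).
set Ar := (n N)%:R^-1 * \sum_(i < n N) hr (xi N i w).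
set Ara := (n N)%:R^-1 * \sum_(i < n N) `|hr (xi N i w)|.
have -> : (n N)%:R^-1 * \sum_(i < n N) h (xi N i w) - mu = Ag + Ar - mr.
  rewrite muE /Ag /Ar /g.
  under eq_bigr do rewrite hE.
  rewrite big_split/= sumrB sumr_const card_ord -[mt *+ _]mulr_natl; by field.
have ArA : `|Ar| <= Ara.
  rewrite normrM ger0_norm ?invr_ge0// ler_wpM2l ?invr_ge0//.
  exact: ler_norm_sum.
apply: contraPP => /not_orP[/negP + /negP].
rewrite -!ltNge => h1 h2; apply/negP; rewrite -ltNge.
have h3 : `|Ag| < e / 3.
  rewrite -(@ltr_pXn2r _ 2)// ?nnegrE ?ltW// real_normK// num_real//.
have := ler_normB (Ag + Ar) mr; have := ler_normD Ag Ar; lra.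
Unshelve. all: by end_near. Qed.

End asymptotic_rows.

(** * Stein's equation *)
(** The mean value theorem. *)
Lemma lipschitz_of_derive (R : realType) (f df : R -> R) (K : R) :
  (forall x : R, is_derive x 1 f (df x)) -> (forall x, `|df x| <= K) ->
  forall x y, `|f x - f y| <= K * `|x - y|.
Proof.
move=> fd fK x y; wlog xy : x y / x < y.
  move=> H; have [/H//|yx|->] := ltgtP x y; last by rewrite !subrr normr0 mulr0.
  by rewrite distrC [`|x - y|]distrC; exact: H.
have cf : {within `[x, y], continuous f}.
  by apply: derivable_within_continuous => z _; case: (fd z).
have [c _ e] := MVT xy (fun z _ => fd z) cf.
by rewrite distrC e normrM [`|x - y|]distrC ler_wpM2r.
Qed.

Section gaussian_density.
Context {R : realType}.

(** The inverse of the standard normal density. *)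
Definition gauss_inv (x : R) := (normal_peak 1)^-1 * expR (x ^+ 2 / 2).

Lemma gauss_invK (x : R) : normal_pdf 0 1 x * gauss_inv x = 1.
Proof.
rewrite normal_pdfE ?oner_neq0// /gauss_inv /normal_fun subr0 expr1n mulNr expRN.
rewrite -[1 *+ 2]/2; field.
by rewrite !gt_eqF ?expR_gt0 ?normal_peak_gt0 ?oner_neq0.
Qed.

Lemma is_derive_gauss_inv (x : R) : is_derive x 1 gauss_inv (x * gauss_inv x).
Proof.
have d1 : is_derive x 1 (fun y : R => y ^+ 2 / 2) x.
  have h := @is_deriveM _ _ (id : R -> R) id x 1 1 1
    (is_derive_id _ _) (is_derive_id _ _).
  have h2 := @is_deriveZ _ _ _ (id * id : R -> R) 2^-1 x 1 _ h.
  have -> : (fun y : R => y ^+ 2 / 2) = 2^-1 *: (id * id : R -> R).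
    by apply/funext => y; rewrite /GRing.scale /= mulrC expr2.
  by apply: (is_derive_eq h2); rewrite /GRing.scale /=; field.
have d2 := @is_derive1_comp _ expR (fun y : R => y ^+ 2 / 2) x _ _ (is_derive_expR _) d1.
have d3 := @is_deriveZ _ _ _ _ (normal_peak 1)^-1 x 1 _ d2.
by apply: (is_derive_eq d3); rewrite /GRing.scale /gauss_inv /=; ring.
Qed.

Lemma continuous_lipschitz (h : R -> R) (L : R) :
  (forall x y, `|h x - h y| <= L * `|x - y|) -> continuous h.
Proof.
move=> hL x; apply/cvgrPdist_le => e e0; have L1 : 0 < `|L| + 1 by rewrite ltr_wpDl.
have eL : 0 < e / (`|L| + 1) by rewrite divr_gt0.
near=> y; apply: (le_trans (hL x y)).
apply: (@le_trans _ _ ((`|L| + 1) * `|x - y|)).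
  by rewrite ler_wpM2r// (le_trans (ler_norm L))// lerDl.
rewrite mulrC -ler_pdivlMr//; near: y.
Unshelve. all: by end_near. Qed.

(** Stein's equation phi' - x phi = h. The solution is the integral of h
    against the normal density p from the left, divided by p. As h vanishes
    outside [-M, M] and has Gaussian mean 0, so does this solution, and all the
    bounds follow from compactness, without any estimate of Gaussian tails. *)
Lemma stein_solution (h : R -> R) (M L : R) : 0 < M ->
  (forall x y, `|h x - h y| <= L * `|x - y|) ->
  (forall x, M <= `|x| -> h x = 0) ->
  (\int[lebesgue_measure]_x (h x * normal_pdf 0 1 x) = 0)%R ->
  exists phi dphi : R -> R, exists C L' : R,
    [/\ forall x : R, is_derive x 1 phi (dphi x),
        forall x, dphi x - x * phi x = h x,
        forall x, `|phi x| <= C,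
        forall x, `|dphi x| <= C &
        forall x y, `|dphi x - dphi y| <= L' * `|x - y| ].
Proof.
move=> M0 hL h0 hint.
have ch := continuous_lipschitz hL.
pose g x := h x * normal_pdf 0 1 x.
have cg : continuous g.
  move=> x; apply: continuousM; first exact: ch.
  exact: continuous_normal_pdf (oner_neq0 _) _.
have g0 x : M <= `|x| -> g x = 0 by move=> /h0 hx; rewrite /g hx mul0r.
(* The integral starts left of the support of h, so that its derivative at
   points x <= a is that of a locally zero function. *)
pose a := - (M + 1).
pose G x := (\int[lebesgue_measure]_(t in `[a, x]) g t)%R.
have ig u : lebesgue_measure.-integrable `[a, u] (EFin \o g).
  apply: continuous_compact_integrable; first exact: segment_compact.
  exact: continuous_subspaceT.
have GlM (x : R) : x <= - M -> G x = 0.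
  move=> xM; rewrite /G (@eq_Rintegral _ _ _ _ _ (fun=> 0)).
    by rewrite Rintegral_cst// mul0r.
  move=> t; rewrite inE /= in_itv /= => /andP[_ tx]; apply: g0.
  by rewrite ler0_norm; lra.
have GgM x : M <= x -> G x = 0.
  move=> Mx; rewrite /G Rintegral_mkcond -[RHS]hint.
  apply: eq_Rintegral => t _; rewrite patchE; case: ifPn => // /negP.
  rewrite inE /= in_itv /= => /negP; rewrite negb_and -!ltNge /a => H.
  apply/esym/g0; case/orP: H => ?; last by rewrite (le_trans _ (ler_norm _))//; lra.
  by rewrite ler0_norm; lra.
have dG (x : R) : is_derive x 1 G (g x).
  have [xa|ax] := leP x a.
    have xM : x < - M by rewrite /a in xa; lra.
    rewrite g0; last by rewrite ler0_norm; lra.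
    apply: (@near_eq_is_derive R R R (cst 0) G x 1 0).
    near=> y; rewrite GlM// ltW//; near: y; exact: lt_nbhsl.
  have [] := @continuous_FTC1_closed _ g a x (x + 1) _ (ig _) ax (cg x).
    by rewrite ltrDl.
  by move=> dGx; rewrite derive1E => <-; exact: DeriveDef.
pose phi x := G x * gauss_inv x.
pose dphi x := h x + x * phi x.
have dphiP (x : R) : is_derive x 1 phi (dphi x).
  have := @is_deriveM _ _ G gauss_inv x 1 _ _ (dG x) (is_derive_gauss_inv x).
  move/is_derive_eq; apply; rewrite /GRing.scale /= /dphi /phi /g.
  transitivity (h x * (normal_pdf 0 1 x * gauss_inv x) + x * (G x * gauss_inv x)).
    by ring.
  by rewrite gauss_invK mulr1.
have phi0 x : M <= `|x| -> phi x = 0.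
  rewrite /phi; case: (leP 0 x) => [x0|x0]; [rewrite ger0_norm//|rewrite ltr0_norm//].
    by move=> /GgM ->; rewrite mul0r.
  by move=> H; rewrite GlM ?mul0r//; lra.
have MM : - M <= M by lra.
have bounded_on (f : R -> R) : continuous f -> (forall x, M <= `|x| -> f x = 0) ->
    exists2 B, 0 <= B & forall x, `|f x| <= B.
  move=> cf f0.
  have cnf : {within `[- M, M], continuous (fun x => `|f x|)}.
    apply: continuous_subspaceT => x; apply: continuous_comp; first exact: cf.
    exact: norm_continuous.
  have [c _ cmax] := EVT_max MM cnf.
  exists `|f c| => // x; have [xM|xM] := leP M `|x|; first by rewrite f0// normr0.
  by apply: cmax; rewrite in_itv /= -ler_norml ltW.
have cphi : continuous phi.
  move=> x; apply/differentiable_continuous/derivable1_diffP.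
  by case: (dphiP x).
have cdphi : continuous dphi.
  move=> x; apply: (@cvgD _ R^o); first exact: ch.
  by apply: cvgM; [exact: cvg_id|exact: cphi].
have dphi0 x : M <= `|x| -> dphi x = 0.
  by move=> Mx; rewrite /dphi h0// phi0// mulr0 addr0.
have [B1 B10 HB1] := bounded_on _ cphi phi0.
have [B2 B20 HB2] := bounded_on _ cdphi dphi0.
exists phi, dphi, (B1 + B2), (L + (B1 + M * B2)); split=> //.
- by move=> x; rewrite /dphi; ring.
- by move=> x; apply: (le_trans (HB1 x)); rewrite lerDl.
- by move=> x; apply: (le_trans (HB2 x)); rewrite lerDr.
- have dx (x : R) : is_derive x 1 (fun y => y * phi y) (phi x + x * dphi x).
    have := @is_deriveM _ _ id phi x 1 _ _ (is_derive_id _ _) (dphiP x).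
    by move/is_derive_eq; apply; rewrite /GRing.scale /=; ring.
  have bdx x : `|phi x + x * dphi x| <= B1 + M * B2.
    apply: (le_trans (ler_normD _ _)); apply: lerD => //.
    have [xM|xM] := leP M `|x|.
      by rewrite dphi0// mulr0 normr0 mulr_ge0// ltW.
    by rewrite normrM ler_pM// ltW.
  move=> x y; have := lipschitz_of_derive dx bdx x y; have := hL x y.
  rewrite /dphi => /= H1 H2.
  rewrite [X in `|X|](_ : _ = (h x - h y) + (x * phi x - y * phi y)); last by ring.
  by apply: (le_trans (ler_normD _ _)); rewrite mulrDl lerD.
Unshelve. all: by end_near. Qed.

End gaussian_density.

(** * Sums of independent copies *)
(** The first bound is used for large u and the second one for small u. *)
Lemma taylor1_bound (R : realType) (phi dphi : R -> R) (C L : R) :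
  (forall x : R, is_derive x 1 phi (dphi x)) ->
  (forall x, `|dphi x| <= C) ->
  (forall x y, `|dphi x - dphi y| <= L * `|x - y|) ->
  forall x u, `|phi (u + x) - phi x - u * dphi x| <= 2 * C * `|u| /\
    `|phi (u + x) - phi x - u * dphi x| <= L * `|u| * `|u|.
Proof.
move=> dp bC bL x u.
have L0 : 0 <= L.
  by have := bL 0 1; rewrite sub0r normrN1 mulr1; apply: le_trans.
have [z zx e] : exists2 z, `|z - x| <= `|u| & phi (u + x) - phi x = u * dphi z.
  have cp a b : {within `[a, b], continuous phi}.
    by apply: derivable_within_continuous => z _; case: (dp z).
  have [u0|u0|->] := ltgtP u 0.
  - have ux : u + x < x by rewrite gtrDr.
    have [z + e] := MVT ux (fun z _ => dp z) (cp _ _).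
    rewrite in_itv /= => /andP[h1 h2]; exists z.
      by rewrite ltr0_norm ?subr_lt0// ltr0_norm//; lra.
    by rewrite -opprB e; ring.
  - have ux : x < u + x by rewrite ltrDr.
    have [z + e] := MVT ux (fun z _ => dp z) (cp _ _).
    rewrite in_itv /= => /andP[h1 h2]; exists z.
      by rewrite gtr0_norm ?subr_gt0// gtr0_norm//; lra.
    by rewrite e; ring.
  - by exists x; rewrite ?subrr ?normr0// add0r subrr mul0r.
rewrite e -mulrBr normrM; split.
  rewrite mulrC ler_wpM2r//; apply: (le_trans (ler_normB _ _)).
  by have := bC z; have := bC x; lra.
rewrite mulrC ler_wpM2r//; apply: (le_trans (bL _ _)).
by rewrite ler_wpM2l.
Qed.

Section stein_row.
Context d dU (T : measurableType d) (U : measurableType dU) (R : realType)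
  (P : probability T R) (n : nat).
Variables (xi : 'I_n -> {RV P >-> U}) (W : {RV P >-> U}).
Hypothesis iid : iid_copies P (fun i => xi i : T -> U) W.
Hypothesis n0 : (0 < n)%N.
Variable h : U -> R.
Hypothesis mh : measurable_fun setT h.
Hypothesis h2 : itg P (fun w => h (W w) ^+ 2).
Hypothesis h0 : \int[P]_w h (W w) = 0.
Hypothesis h1 : \int[P]_w (h (W w) ^+ 2) = 1.

Let c : R := (Num.sqrt n%:R)^-1.

Let c2 : c * c = n%:R^-1.
Proof. by rewrite /c -invfM -expr2 sqr_sqrtr. Qed.

Let c0 : 0 <= c. Proof. by rewrite invr_ge0 sqrtr_ge0. Qed.

(** Write S for the normalized sum and S_i for S without its i-th summand
    c h_i, which is independent of S_i. Then
    E(h_i phi(S)) = E(h_i (phi(S) - phi(S_i))) is c E(phi'(S_i)) up to the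
    remainder of taylor1_bound, and the sum over i of c E(h_i phi(S)) is
    close to E(phi'(S)). The remainder is quadratic in c h_i where h_i^2 <= K
    and linear elsewhere, whence the tail of h^2 in the bound. *)
Lemma stein_bound (phi dphi : R -> R) (C L K : R) :
  (forall x : R, is_derive x 1 phi (dphi x)) ->
  (forall x, `|phi x| <= C) ->
  (forall x, `|dphi x| <= C) ->
  (forall x y, `|dphi x - dphi y| <= L * `|x - y|) ->
  0 <= K ->
  let S w := c * \sum_(i < n) h (xi i w) in
  itg P (fun w => dphi (S w) - S w * phi (S w)) /\
  `|\int[P]_w (dphi (S w) - S w * phi (S w))| <=
  L * c * \int[P]_w `|h (W w)| +
  (2 * C * \int[P]_w (h (W w) ^+ 2 * (K < h (W w) ^+ 2)%R%:R) + L * c * (K + 1)).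
Proof.
move=> dp bp bC bL K0 S.
have L0 : 0 <= L.
  by have := bL 0 1; rewrite sub0r normrN1 mulr1; apply: le_trans.
have C0 : 0 <= C by apply: le_trans (bp 0).
have cphi : continuous phi.
  by move=> x; apply/differentiable_continuous/derivable1_diffP; case: (dp x).
have mphi : measurable_fun setT phi by exact: continuous_measurable_fun.
have mdphi : measurable_fun setT dphi.
  by apply: continuous_measurable_fun; exact: continuous_lipschitz bL.
have mhW : measurable_fun setT (fun w => h (W w)) by exact: measurableT_comp.
have hW := itg_sqr mhW h2.
have mh2 : measurable_fun setT (fun u => h u ^+ 2) by exact: measurable_funX.
have mch : measurable_fun setT (fun u => c * h u) by exact: measurable_funM.
have mha : measurable_fun setT (fun u => `|h u|) by exact: measurableT_comp.
pose k u := c * h u.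
pose Si i w := \sum_(j < n | j != i) k (xi j w).
have SE i w : S w = c * h (xi i w) + Si i w.
  by rewrite /S mulr_sumr (bigD1 i).
have mhi i : measurable_fun setT (fun w => h (xi i w)) by exact: measurableT_comp.
have mS : measurable_fun setT S.
  by apply: measurable_funM => //; apply: measurable_sum => i.
have mSi i : measurable_fun setT (Si i).
  rewrite (_ : Si i = fun w => S w - c * h (xi i w)); last first.
    by apply/funext => w; rewrite (SE i) addrC addKr.
  by apply: measurable_funB => //; exact: measurable_funM.
have mpS : measurable_fun setT (fun w => phi (S w)) by exact: measurableT_comp.
have mdS : measurable_fun setT (fun w => dphi (S w)) by exact: measurableT_comp.
have idS : itg P (fun w => dphi (S w)) by apply: itg_bounded => // w; exact: bC.
have idSi i : itg P (fun w => dphi (Si i w)).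
  by apply: itg_bounded => [|w]; [exact: measurableT_comp|exact: bC].
have ipSi i : itg P (fun w => phi (Si i w)).
  by apply: itg_bounded => [|w]; [exact: measurableT_comp|exact: bp].
have [hi hi2 hia] : [/\ forall i, itg P (fun w => h (xi i w)) /\ \int[P]_w h (xi i w) = 0,
    forall i, itg P (fun w => h (xi i w) ^+ 2) /\ \int[P]_w (h (xi i w) ^+ 2) = 1 &
    forall i, itg P (fun w => `|h (xi i w)|) /\
      \int[P]_w `|h (xi i w)| = \int[P]_w `|h (W w)| ].
  split=> i.
  - by have [? ->] := row_transfer iid i mh hW.
  - by have [? ->] := row_transfer iid i mh2 h2.
  - by have := row_transfer iid i mha (itg_norm hW).
have ihp i : itg P (fun w => h (xi i w) * phi (S w)).
  apply: (itg_le _ _ (itgZ C (itg_norm (hi i).1))).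
    exact: measurable_funM.
  by move=> w; rewrite normrM mulrC ler_wpM2r//; exact: bp.
(* Here the independence of xi i from the other summands is used. *)
have [ihpi ehpi] : (forall i, itg P (fun w => h (xi i w) * phi (Si i w))) /\
    forall i, \int[P]_w (h (xi i w) * phi (Si i w)) = 0.
  suff H i : itg P (fun w => h (xi i w) * phi (Si i w)) /\
      \int[P]_w (h (xi i w) * phi (Si i w)) = 0 by split=> i; case: (H i).
  have [i1 ->] := mean_indep (indep_rest iid i mh mch mphi) (hi i).1 (ipSi i).
  by rewrite (hi i).2 mul0r.
have [ihdi ehdi] : (forall i, itg P (fun w => h (xi i w) ^+ 2 * dphi (Si i w))) /\
    forall i, \int[P]_w (h (xi i w) ^+ 2 * dphi (Si i w)) = \int[P]_w dphi (Si i w).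
  suff H i : itg P (fun w => h (xi i w) ^+ 2 * dphi (Si i w)) /\
      \int[P]_w (h (xi i w) ^+ 2 * dphi (Si i w)) = \int[P]_w dphi (Si i w).
    by split=> i; case: (H i).
  have [i1 ->] := mean_indep (indep_rest iid i mh2 mch mdphi) (hi2 i).1 (idSi i).
  by rewrite (hi2 i).2 mul1r.
(* h_i times the remainder of the first-order expansion of phi at S_i *)
pose X i w := h (xi i w) * (phi (S w) - phi (Si i w) - c * h (xi i w) * dphi (Si i w)).
have XE i w : X i w = h (xi i w) * phi (S w) - h (xi i w) * phi (Si i w)
    - c * (h (xi i w) ^+ 2 * dphi (Si i w)) by rewrite /X; ring.
have iX i : itg P (X i).
  by apply: (eq_itg (itgB (itgB (ihp i) (ihpi i)) (itgZ c (ihdi i)))) => w; rewrite XE.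
have eX i : \int[P]_w X i w =
    \int[P]_w (h (xi i w) * phi (S w)) - c * \int[P]_w dphi (Si i w).
  under eq_Rintegral do rewrite XE.
  rewrite meanB ?meanB ?meanZ// ?ehpi ?ehdi ?subr0//; first exact: itgB.
  exact: itgZ.
pose b u := h u ^+ 2 * (K < h u ^+ 2)%R%:R.
have mb : measurable_fun setT b.
  apply: measurable_funM => //.
  rewrite [X in measurable_fun _ X](_ : _ = \1_(~` [set u | h u ^+ 2 <= K])); last first.
    by apply/funext => u; rewrite indicE ltNge in_setC mem_setE.
  apply: measurable_indic; apply: measurableC.
  by rewrite -[X in measurable X]setTI; apply: measurable_fun_le.
have ib : itg P (fun w => b (W w)).
  apply: (itg_le _ _ h2); first exact: measurableT_comp.
  move=> w; rewrite /b normrM ger0_norm ?sqr_ge0// ler_piMr ?sqr_ge0//.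
  by rewrite ger0_norm// lern1 leq_b1.
have hib i := row_transfer iid i mb ib.
have Xle i w : `|X i w| <= c * (2 * C * b (xi i w) + L * c * (K + 1) * h (xi i w) ^+ 2).
  have [t1 t2] := taylor1_bound dp bC bL (Si i w) (c * h (xi i w)).
  rewrite -SE in t1 t2.
  rewrite /X normrM; set x := h (xi i w) in t1 t2 *.
  have xx : `|x| * `|x| = x ^+ 2 by rewrite -normrM -expr2 ger0_norm ?sqr_ge0.
  have x20 := sqr_ge0 x.
  rewrite normrM (ger0_norm c0) in t1 t2.
  rewrite /b -/x; have [Kx|Kx] := ltP K (x ^+ 2).
    apply: (@le_trans _ _ (`|x| * (2 * C * (c * `|x|)))); first by rewrite ler_wpM2l.
    rewrite (_ : `|x| * _ = c * (2 * C * (`|x| * `|x|))); last by ring.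
    rewrite xx mulr1 ler_wpM2l// lerDl mulr_ge0//.
    by rewrite !mulr_ge0// addr_ge0.
  apply: (@le_trans _ _ (`|x| * (L * (c * `|x|) * (c * `|x|)))); first by rewrite ler_wpM2l.
  rewrite (_ : `|x| * _ = c * (L * c * (`|x| * (`|x| * `|x|)))); last by ring.
  rewrite xx mulr0 mulr0 add0r ler_wpM2l// -[leRHS]mulrA ler_wpM2l ?mulr_ge0//.
  rewrite ler_wpM2r//.
  have := normr_ge0 x; have := sqr_ge0 (`|x| - 1); rewrite -xx in Kx *; nra.
have eXle i : `|\int[P]_w X i w| <= c * (2 * C * \int[P]_w b (W w) + L * c * (K + 1)).
  have i1 := itgZ (2 * C) (hib i).1; have i2 := itgZ (L * c * (K + 1)) (hi2 i).1.
  apply: le_trans (mean_norm_le (itg_meas (iX i)) (itgZ c (itgD i1 i2)) (Xle i)) _.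
  rewrite meanZ; last exact: itgD.
  by rewrite meanD// !meanZ ?(hib i).1 ?(hi2 i).1// (hib i).2 (hi2 i).2 mulr1.
have eDle i : `|\int[P]_w dphi (S w) - \int[P]_w dphi (Si i w)| <=
    L * c * \int[P]_w `|h (W w)|.
  rewrite -meanB// -(hia i).2 -meanZ; last exact: (hia i).1.
  apply: mean_norm_le; first by apply: measurable_funB => //; exact: measurableT_comp.
    by apply: itgZ; exact: (hia i).1.
  move=> w; apply: (le_trans (bL _ _)); rewrite (SE i) addrK normrM (ger0_norm c0).
  by rewrite mulrA.
have SphiE w : S w * phi (S w) = c * \sum_(i < n) (h (xi i w) * phi (S w)).
  by rewrite -mulr_suml /S mulrA.
have isum : itg P (fun w => \sum_(i < n) (h (xi i w) * phi (S w))) by exact: itg_sum.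
have iSphi : itg P (fun w => S w * phi (S w)).
  by apply: (eq_itg (itgZ c isum)) => w; rewrite SphiE.
split; first exact: itgB.
rewrite meanB//.
have -> : \int[P]_w (S w * phi (S w)) =
    c * \sum_(i < n) (\int[P]_w X i w + c * \int[P]_w dphi (Si i w)).
  under eq_Rintegral do rewrite SphiE.
  rewrite meanZ// mean_sum//; congr (_ * _); apply: eq_bigr => i _.
  by rewrite eX subrK.
have nn0 : n%:R != 0 :> R by rewrite pnatr_eq0 -lt0n.
have -> : \int[P]_w dphi (S w) -
    c * \sum_(i < n) (\int[P]_w X i w + c * \int[P]_w dphi (Si i w)) =
  \sum_(i < n) (n%:R^-1 * (\int[P]_w dphi (S w) - \int[P]_w dphi (Si i w))
     - c * \int[P]_w X i w).
  rewrite sumrB -!mulr_sumr sumrB sumr_const card_ord big_split /= -mulr_sumr.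
  rewrite -[_ *+ n]mulr_natl mulrDr mulrA c2; by field.
apply: (le_trans (ler_norm_sum _ _ _)).
apply: (@le_trans _ _ (\sum_(i < n) n%:R^-1 * (L * c * \int[P]_w `|h (W w)| +
  (2 * C * \int[P]_w b (W w) + L * c * (K + 1))))).
  apply: ler_sum => i _; apply: (le_trans (ler_normB _ _)).
  rewrite [leRHS]mulrDr; apply: lerD.
    by rewrite normrM ger0_norm ?invr_ge0// ler_wpM2l ?invr_ge0.
  by rewrite normrM (ger0_norm c0) -c2 -[leRHS]mulrA ler_wpM2l.
rewrite sumr_const card_ord -[X in X <= _]mulr_natl mulrA divff// mul1r.
by [].
Qed.

End stein_row.

(** * The central limit theorem *)
Section trapezoid.
Context {R : realType}.
Implicit Types x y z : R.

(** 1 on [-y, y], 0 outside [-z, z] and affine in between: a Lipschitz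
    function between the indicators of the two intervals. *)
Definition trapezoid y z x : R := Num.max 0 (Num.min 1 ((z - `|x|) / (z - y))).

Lemma trapezoid01 y z x : 0 <= trapezoid y z x <= 1.
Proof. by rewrite /trapezoid le_max lexx ge_max ler01 ge_min lexx. Qed.

Lemma trapezoid_in y z x : y < z -> `|x| <= y -> trapezoid y z x = 1.
Proof.
move=> yz xy; have zy : 0 < z - y by rewrite subr_gt0.
rewrite /trapezoid min_l; first by rewrite max_r.
by rewrite ler_pdivlMr// mul1r; lra.
Qed.

Lemma trapezoid_out y z x : y < z -> z <= `|x| -> trapezoid y z x = 0.
Proof.
move=> yz xz; have zy : 0 < z - y by rewrite subr_gt0.
have h : (z - `|x|) / (z - y) <= 0 by rewrite ler_pdivrMr// mul0r; lra.
by rewrite /trapezoid max_l// ge_min h orbT.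
Qed.

Lemma trapezoid_lipschitz y z x x' : y < z ->
  `|trapezoid y z x - trapezoid y z x'| <= (z - y)^-1 * `|x - x'|.
Proof.
move=> yz; have zy : 0 < (z - y)^-1 by rewrite invr_gt0 subr_gt0.
have max_lip (a b c : R) : `|Num.max c a - Num.max c b| <= `|a - b|.
  have n1 := ler_norm (a - b); have n2 := lerNnormlW (lexx `|a - b|).
  by rewrite ler_norml !maxEle; do ![case: ifPn; rewrite -?ltNge => ?]; lra.
have min_lip (a b c : R) : `|Num.min c a - Num.min c b| <= `|a - b|.
  have n1 := ler_norm (a - b); have n2 := lerNnormlW (lexx `|a - b|).
  by rewrite ler_norml !minEle; do ![case: ifPn; rewrite -?ltNge => ?]; lra.
apply: (le_trans (max_lip _ _ _)); apply: (le_trans (min_lip _ _ _)).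
rewrite -mulrBl normrM mulrC (gtr0_norm zy).
rewrite ler_wpM2l ?(ltW zy)//.
by rewrite (_ : _ - (z - _) = `|x'| - `|x|); [rewrite [leRHS]distrC ler_dist_dist|ring].
Qed.

Lemma continuous_trapezoid y z : y < z -> continuous (trapezoid y z).
Proof.
move=> yz; apply: (@continuous_lipschitz _ _ (z - y)^-1) => x x'.
exact: trapezoid_lipschitz.
Qed.

(** The mean of f under the standard normal law. *)
Definition gauss_mean (f : R -> R) : R :=
  (\int[lebesgue_measure]_x (f x * normal_pdf 0 1 x))%R.

Lemma gauss_itg (f : R -> R) (c : R) : measurable_fun setT f -> (forall x, `|f x| <= c) ->
  lebesgue_measure.-integrable setT (EFin \o (fun x => f x * normal_pdf 0 1 x)).
Proof.
move=> mf fc.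
have i1 := @integrable_normal_pdf R 0 1.
have i2 := integrableZl measurableT `|c| i1.
apply: (le_integrable measurableT _ _ i2).
  by apply/measurable_EFinP; apply: measurable_funM => //; exact: measurable_normal_pdf.
move=> x _ /=; rewrite lee_fin !normrM normr_id ler_wpM2r//.
by apply: le_trans (fc x) _; exact: ler_norm.
Qed.

Lemma gauss_mean1 : gauss_mean (fun=> 1) = 1.
Proof.
rewrite /gauss_mean /Rintegral.
by under eq_integral do rewrite mul1r; rewrite integral_normal_pdf.
Qed.

Lemma gauss_mean_trapezoid_le1 y z : y < z -> gauss_mean (trapezoid y z) <= 1.
Proof.
move=> yz; rewrite -[leRHS]gauss_mean1; apply: le_Rintegral => //.
- apply: (@gauss_itg _ 1) => [|x].
    exact: continuous_measurable_fun (continuous_trapezoid yz).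
  by have /andP[? ?] := trapezoid01 y z x; rewrite ger0_norm.
- by apply: (@gauss_itg _ 1) => [|x]; [exact: measurable_cst|rewrite normr1].
- move=> x _; rewrite ler_wpM2r ?normal_pdf_ge0//.
  by have /andP[] := trapezoid01 y z x.
Qed.

Lemma gauss_mean_trapezoid_ge y z : y < z ->
  fine (normal_prob 0 1 `[- y, y]) <= gauss_mean (trapezoid y z).
Proof.
move=> yz; rewrite /normal_prob -/(Rintegral _ _ _) Rintegral_mkcond.
have mt := continuous_measurable_fun (continuous_trapezoid yz).
apply: le_Rintegral => //.
- rewrite -restrict_EFin; apply/integrable_restrict => //.
  rewrite setTI; apply: (integrableS measurableT) => //.
  exact: integrable_normal_pdf.
- apply: (@gauss_itg _ 1) => // x.
  by have /andP[? ?] := trapezoid01 y z x; rewrite ger0_norm.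
- move=> x _; rewrite patchE; case: ifPn => [|_].
    rewrite inE /= in_itv /= -ler_norml => xy.
    by rewrite trapezoid_in// mul1r.
  by rewrite mulr_ge0 ?normal_pdf_ge0//; have /andP[] := trapezoid01 y z x.
Qed.

End trapezoid.

(** The density is bounded below on a bounded interval. *)
Lemma normal_prob_itv_gt0 (R : realType) (a b : R) : a < b ->
  (0 < normal_prob 0 1 `[a, b])%E.
Proof.
move=> ab; pose m : R := Num.max `|a| `|b|.
pose r : R := normal_peak 1 * expR (- m ^+ 2 / 2).
have r0 : 0 < r by rewrite mulr_gt0 ?expR_gt0// normal_peak_gt0// oner_neq0.
have rle (x : R) : a <= x -> x <= b -> r <= normal_pdf 0 1 x.
  move=> ax xb; have xm : `|x| <= m.
    have [x0|x0] := leP 0 x.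
      rewrite ger0_norm// /m le_max; apply/orP; right.
      by apply: (le_trans xb); exact: ler_norm.
    rewrite ltr0_norm// /m le_max; apply/orP; left.
    by rewrite -normrN; apply: le_trans (ler_norm _); rewrite lerN2.
  rewrite normal_pdfE ?oner_neq0// ler_wpM2l ?normal_peak_ge0// ler_expR subr0.
  rewrite expr1n -[1 *+ 2]/2 ler_wpM2r// lerN2 -(real_normK (num_real x)).
  by rewrite ler_pXn2r ?nnegrE// (le_trans _ xm).
apply: (@lt_le_trans _ _ (\int[lebesgue_measure]_(x in `[a, b]) r%:E)%E).
  rewrite integral_cst//= lebesgue_measure_itv/= lte_fin ab -EFinB -EFinM lte_fin.
  by rewrite mulr_gt0// subr_gt0.
apply: ge0_le_integral => //.
- by move=> x _; rewrite lee_fin ltW.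
- apply/measurable_funTS/measurableT_comp => //; exact: measurable_normal_pdf.
- by move=> x /=; rewrite in_itv /= lee_fin => /andP[]; exact: rle.
Qed.

Section clt.
Context d dU (T : measurableType d) (U : measurableType dU) (R : realType)
  (P : probability T R) (n : nat -> nat).
Variables (xi : forall N, 'I_(n N) -> {RV P >-> U}) (W : {RV P >-> U}).
Arguments xi : clear implicits.
Hypothesis iid : forall N, iid_copies P (fun i => xi N i : T -> U) W.
Hypothesis noo : n N @[N --> \oo] --> \oo.
Variable h : U -> R.
Hypothesis mh : measurable_fun setT h.
Hypothesis h2 : itg P (fun w => h (W w) ^+ 2).
Hypothesis h0 : \int[P]_w h (W w) = 0.

Definition nsum N w : R := (Num.sqrt (n N)%:R)^-1 * \sum_(i < n N) h (xi N i w).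

Lemma near_n_gt0 : \forall N \near \oo, (0 < n N)%N.
Proof. by apply: (near_n noo (Q := fun k => (0 < k)%N)); exists 1%N. Qed.

Lemma near_sqrt_n (C e : R) : 0 < e ->
  \forall N \near \oo, C * (Num.sqrt (n N)%:R)^-1 <= e.
Proof.
move=> e0; apply: (near_n noo (Q := fun k => C * (Num.sqrt k%:R)^-1 <= e)).
have e2 : 0 < e ^+ 2 by rewrite exprn_gt0.
have H := n_inv_le (C ^+ 2) e2; near=> k.
have k0 : (0 : R) < k%:R by rewrite ltr0n; near: k; exists 1%N.
have s0 : 0 < Num.sqrt (k%:R : R) by rewrite sqrtr_gt0.
have [C0|C0] := leP C 0.
  by apply: (@le_trans _ _ 0); [rewrite mulr_le0_ge0// invr_ge0 ltW|exact: ltW].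
rewrite -(@ler_pXn2r _ 2)// ?nnegrE ?mulr_ge0 ?invr_ge0 ?(ltW C0) ?(ltW s0) ?(ltW e0)//.
rewrite exprMn exprVn sqr_sqrtr ?(ltW k0)// mulrC; near: k; exact: H.
Unshelve. all: by end_near. Qed.

Lemma measurable_nsum N : measurable_fun setT (nsum N).
Proof.
apply: measurable_funM => //; apply: measurable_sum => i.
exact: measurableT_comp.
Qed.

Lemma nsum_sqr N : (0 < n N)%N -> itg P (fun w => nsum N w ^+ 2) /\
  \int[P]_w (nsum N w ^+ 2) = \int[P]_w (h (W w) ^+ 2).
Proof.
move=> n0; have [i1 e1] := row_sum_sqr (iid N) mh h2 h0.
have nn0 : (n N)%:R != 0 :> R by rewrite pnatr_eq0 -lt0n.
have c2 : (Num.sqrt (n N)%:R)^-1 ^+ 2 = (n N)%:R^-1 :> R by rewrite exprVn sqr_sqrtr.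
split; first by apply: (eq_itg (itgZ (n N)%:R^-1 i1)) => w; rewrite /nsum exprMn c2.
under eq_Rintegral do rewrite /nsum exprMn c2.
by rewrite meanZ// e1 mulrA mulVf// mul1r.
Qed.

(** All the normalized sums have the same variance. *)
Lemma tight_nsum : tight P nsum.
Proof.
apply: (@tight_L2 _ _ _ _ _ (\int[P]_w (h (W w) ^+ 2))).
by apply: filterS near_n_gt0 => N n0; have [? ->] := nsum_sqr n0.
Qed.

Hypothesis h1 : \int[P]_w (h (W w) ^+ 2) = 1.

(** The mean of g at a normalized sum is the mean of phi' - x phi, which
    stein_bound makes small; K is chosen before N. *)
Lemma clt_test (g : R -> R) (M L : R) : 0 < M ->
  (forall x y, `|g x - g y| <= L * `|x - y|) ->
  (forall x, M <= `|x| -> g x = 0) -> gauss_mean g = 0 ->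
  forall e, 0 < e -> \forall N \near \oo, `|\int[P]_w g (nsum N w)| <= e.
Proof.
move=> M0 gL gM g0 e e0.
have [phi [dphi [C [L' [dp dphiE bp bd dL]]]]] := stein_solution M0 gL gM g0.
have C0 : 0 <= C by apply: le_trans (bp 0).
have h2ge w : 0 <= h (W w) ^+ 2 by exact: sqr_ge0.
have C1 : 0 < 2 * C + 1 by lra.
have t0 : 0 < e / 2 / (2 * C + 1) by rewrite !divr_gt0.
have [K K0 HK] := mean_tail h2 h2ge t0.
pose B := L' * \int[P]_w `|h (W w)| + L' * (K + 1).
have e20 : 0 < e / 2 by rewrite divr_gt0.
have H1 := near_sqrt_n B e20; have H2 := near_n_gt0.
near=> N.
have n0 : (0 < n N)%N by near: N.
have [_] := stein_bound (iid N) n0 mh h2 h0 h1 dp bp bd dL (ltW K0).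
under eq_Rintegral do rewrite -/(nsum N _) dphiE.
move=> /le_trans; apply.
set c := (Num.sqrt (n N)%:R)^-1.
have Hc : B * c <= e / 2 by rewrite /c; near: N.
set tail := (X in 2 * C * X).
have tail0 : 0 <= tail by apply: mean_ge0 => w; rewrite mulr_ge0.
have Ht : 2 * C * tail <= e / 2.
  apply: (@le_trans _ _ ((2 * C + 1) * tail)); first by rewrite ler_wpM2r// lerDl.
  by rewrite mulrC -ler_pdivlMr.
rewrite /B in Hc; lra.
Unshelve. all: by end_near. Qed.

(** The central limit theorem, as a bound for the probability of leaving an
    interval. The trapezoid f of the interval is made a test function of mean 0
    by subtracting the multiple c0 k of a trapezoid k so wide that, by
    Chebyshev's inequality, the mean of k at any normalized sum is nearly 1.
    The mean of f at the normalized sum is thus nearly c0, which is at least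
    the Gaussian mean of f. *)
Theorem clt (y z : R) : 0 <= y -> y < z ->
  asymp_le P (fun N => [set w | z <= `|nsum N w|])
    (1 - fine (normal_prob 0 1 `[- y, y])).
Proof.
move=> y0 yz e e0; have e40 : 0 < e / 4 by rewrite divr_gt0.
pose K : R := 1 + 4 / e; have K0 : 1 <= K by rewrite lerDl divr_ge0 ?ltW.
have K2 : (K ^+ 2)^-1 <= e / 4.
  rewrite -[e / 4]invrK lef_pV2 ?posrE ?invr_gt0// ?exprn_gt0//; last by lra.
  rewrite invf_div; apply: (@le_trans _ _ K); first by rewrite lerDr.
  by rewrite expr2 ler_peMl//; lra.
have KK : K < K + 1 by rewrite ltrDl.
pose f := trapezoid y z; pose k := trapezoid K (K + 1).
have [f0 k0] : gauss_mean f <= 1 /\ gauss_mean k <= 1.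
  by split; exact: gauss_mean_trapezoid_le1.
have mf : measurable_fun setT f := continuous_measurable_fun (continuous_trapezoid yz).
have mk : measurable_fun setT k := continuous_measurable_fun (continuous_trapezoid KK).
have fb x : `|f x| <= 1 by have /andP[? ?] := trapezoid01 y z x; rewrite ger0_norm.
have kb x : `|k x| <= 1 by have /andP[? ?] := trapezoid01 K (K + 1) x; rewrite ger0_norm.
have fge : 0 <= gauss_mean f.
  apply: Rintegral_ge0 => x _; rewrite mulr_ge0 ?normal_pdf_ge0//.
  by have /andP[] := trapezoid01 y z x.
have kgt : 0 < gauss_mean k.
  apply: lt_le_trans (gauss_mean_trapezoid_ge KK).
  apply: fine_gt0; rewrite normal_prob_itv_gt0 /=; last by lra.
  by rewrite -ge0_fin_numE// fin_num_measure.
pose c0 := gauss_mean f / gauss_mean k.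
have c00 : 0 <= c0 by rewrite divr_ge0// ltW.
have c0f : gauss_mean f <= c0 by rewrite ler_pdivlMr// ler_piMr.
pose g x := f x - c0 * k x.
have g0 : gauss_mean g = 0.
  rewrite /gauss_mean.
  have -> : (\int[lebesgue_measure]_x (g x * normal_pdf 0 1 x))%R =
      gauss_mean f - c0 * gauss_mean k.
    rewrite /gauss_mean -RintegralZl//; last exact: gauss_itg kb.
    rewrite -RintegralB//; last 2 first.
    - exact: gauss_itg fb.
    - exact: (integrableZl measurableT c0 (gauss_itg mk kb)).
    by apply: eq_Rintegral => x _; rewrite /g; ring.
  by rewrite /c0 divfK ?subrr// gt_eqF.
have zM : 0 < Num.max z (K + 1) by rewrite lt_max (le_lt_trans y0 yz).
have gL x x' : `|g x - g x'| <= ((z - y)^-1 + c0) * `|x - x'|.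
  rewrite (_ : g x - g x' = (f x - f x') - c0 * (k x - k x')); last by rewrite /g; ring.
  apply: (le_trans (ler_normB _ _)); rewrite mulrDl; apply: lerD.
    exact: trapezoid_lipschitz.
  rewrite normrM ger0_norm// ler_wpM2l//.
  apply: (le_trans (trapezoid_lipschitz _ _ KK)).
  by rewrite addrAC subrr add0r invr1 mul1r.
have gM x : Num.max z (K + 1) <= `|x| -> g x = 0.
  rewrite ge_max => /andP[h3 h4].
  by rewrite /g /f /k !trapezoid_out// mulr0 subrr.
have H1 := clt_test zM gL gM g0 e40; have H2 := near_n_gt0.
near=> N.
have n0 : (0 < n N)%N by near: N.
have mS := @measurable_nsum N.
have ifS : itg P (fun w => f (nsum N w)).
  by apply: itg_bounded => [|w]; [exact: measurableT_comp|exact: fb].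
have ikS : itg P (fun w => k (nsum N w)).
  by apply: itg_bounded => [|w]; [exact: measurableT_comp|exact: kb].
have i1 : itg P (fun w => 1 - f (nsum N w)) by apply: itgB => //; exact: itg_cst.
have i1ge w : 0 <= 1 - f (nsum N w).
  by rewrite subr_ge0; have /andP[] := trapezoid01 y z (nsum N w).
have [mB PB] := markov_mean i1 i1ge ltr01.
exists [set w | 1 <= 1 - f (nsum N w)] => //; split.
  by move=> w /= zw; rewrite /f trapezoid_out// subr0.
apply: (le_trans PB); rewrite lee_fin invr1 mul1r.
rewrite meanB//; last exact: itg_cst.
rewrite mean_cst.
have Hg : `|\int[P]_w g (nsum N w)| <= e / 4 by near: N.
rewrite meanB// in Hg; last exact: itgZ.
rewrite meanZ// in Hg.
have Hk : 1 - e / 4 <= \int[P]_w k (nsum N w).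
  have [iS2 eS2] := nsum_sqr n0; rewrite h1 in eS2.
  apply: (@le_trans _ _ (\int[P]_w (1 - (K ^+ 2)^-1 * nsum N w ^+ 2))).
    rewrite meanB//; [|exact: itg_cst|exact: itgZ].
    by rewrite mean_cst meanZ// eS2; lra.
  apply: mean_le => //; first by apply: itgB; [exact: itg_cst|exact: itgZ].
  move=> w; have [hK|hK] := leP `|nsum N w| K.
    by rewrite /k trapezoid_in// gerBl mulr_ge0 ?invr_ge0 ?sqr_ge0.
  apply: (@le_trans _ _ 0); last by have /andP[] := trapezoid01 K (K + 1) (nsum N w).
  rewrite subr_le0 mulrC ler_pdivlMr ?exprn_gt0//; last by lra.
  rewrite mul1r -(real_normK (num_real (nsum N w))) ler_pXn2r ?nnegrE ?normr_ge0 ?ltW//.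
  lra.
have Hfy := gauss_mean_trapezoid_ge yz.
have /andP[_ Ef1] : 0 <= gauss_mean f <= 1 by rewrite fge f0.
move: Hg; rewrite ler_norml => /andP[Hg _].
have : gauss_mean f * (1 - e / 4) <= c0 * \int[P]_w k (nsum N w).
  have [e1|e1] := leP 0 (1 - e / 4); first by rewrite ler_pM.
  apply: (@le_trans _ _ 0); first by rewrite mulr_ge0_le0// ltW.
  by rewrite mulr_ge0// mean_ge0// => w; have /andP[] := trapezoid01 K (K + 1) (nsum N w).
rewrite -/f in Hfy; nra.
Unshelve. all: by end_near. Qed.

End clt.

Lemma nsum_linear d dU (T : measurableType d) (U : measurableType dU)
    (R : realType) (P : probability T R) (n : nat -> nat)
    (xi : forall N, 'I_(n N) -> {RV P >-> U}) (f g : U -> R) (x y : R) N w :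
  nsum xi (fun u => x * f u + y * g u) N w =
  x * nsum xi f N w + y * nsum xi g N w.
Proof. by rewrite /nsum big_split/= -!mulr_sumr; ring. Qed.

(** * Gaussian quantiles *)
Section gaussian_quantile.
Context {R : realType}.
Local Notation N01 := (normal_prob (0 : R) 1).
Implicit Types x y : R.

Lemma Phi_EFin x : (Phi x)%:E = N01 `]-oo, x].
Proof. by rewrite /Phi fineK// fin_num_measure. Qed.

Lemma Phi_open x : (Phi x)%:E = N01 `]-oo, x[.
Proof.
rewrite Phi_EFin /normal_prob integral_itv_bndo_bndc//.
by apply: measurable_funTS; apply: measurableT_comp => //; exact: measurable_normal_pdf.
Qed.

(** Single points have measure 0. *)
Lemma Phi_itv x y : x <= y -> fine (N01 `[x, y]) = Phi y - Phi x.
Proof.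
move=> xy; apply/EFin_inj; rewrite fineK ?fin_num_measure// EFinB.
rewrite Phi_EFin Phi_open.
have -> : `]-oo, y]%classic = `]-oo, x[ `|` `[x, y].
  by apply: itv_bndbnd_setU; rewrite bnd_simp.
rewrite measureU//; last first.
  apply/seteqP; split => // z [] /=; rewrite !in_itv/= => zx /andP[xz _].
  by move: (lt_le_trans zx xz); rewrite ltxx.
by rewrite addeAC subee ?add0e// fin_num_measure.
Qed.

Lemma Phi_ndec x y : x <= y -> Phi x <= Phi y.
Proof. by move=> xy; rewrite -subr_ge0 -Phi_itv// fine_ge0. Qed.

Lemma Phi_lipschitz x y : `|Phi x - Phi y| <= normal_peak 1 * `|x - y|.
Proof.
wlog xy : x y / x <= y.
  move=> H; have [/H//|/ltW/H] := leP x y.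
  by rewrite distrC [`|y - x|]distrC.
rewrite distrC [`|x - y|]distrC -Phi_itv// ger0_norm ?fine_ge0//.
rewrite ger0_norm ?subr_ge0//.
rewrite -lee_fin fineK ?fin_num_measure//.
apply: (@le_trans _ _ (\int[lebesgue_measure]_(x in `[x, y]) (normal_peak 1 : R)%:E)%E).
  apply: ge0_le_integral => //.
  - by move=> z _; rewrite lee_fin normal_pdf_ge0.
  - apply/measurable_funTS/measurableT_comp => //; exact: measurable_normal_pdf.
  - by move=> z _; rewrite lee_fin normal_pdf_ub// oner_neq0.
rewrite integral_cst//= lebesgue_measure_itv/= lte_fin.
case: ltP => [_|yx]; first by rewrite -EFinB -EFinM.
by rewrite mule0 lee_fin mulr_ge0 ?normal_peak_ge0// subr_ge0.
Qed.

Lemma continuous_Phi : continuous (@Phi R).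
Proof. exact: continuous_lipschitz Phi_lipschitz. Qed.

(** The density is even. *)
Lemma PhiN x : Phi (- x) = 1 - Phi x.
Proof.
apply/EFin_inj; rewrite Phi_EFin EFinB /normal_prob.
have cp := @continuous_normal_pdf R 0 1 (oner_neq0 _).
rewrite ge0_integration_by_substitutionNy; last 2 first.
- exact: continuous_subspaceT.
- by move=> z _; exact: normal_pdf_ge0.
have -> : normal_pdf (0 : R) 1 \o -%R = normal_pdf 0 1.
  by apply/funext => z /=; rewrite !normal_pdfE ?oner_neq0// /normal_fun !subr0 sqrrN.
rewrite -[LHS]/(N01 `[x, +oo[) Phi_open.
rewrite -[1%:E](@probability_setT _ _ _ (normal_prob (0 : R) 1)).
have -> : [set: R] = `]-oo, x[ `|` `[x, +oo[.
  by rewrite -itv_bndbnd_setU// set_itvE.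
rewrite measureU//; last first.
  apply/seteqP; split => // z [] /=; rewrite !in_itv/= andbT => zx xz.
  by move: (lt_le_trans zx xz); rewrite ltxx.
by rewrite addeAC subee ?add0e// fin_num_measure.
Qed.

(** The intermediate value theorem between the two limits of Phi. *)
Lemma Phi_onto (v : R) : 0 < v < 1 -> exists x, Phi x = v.
Proof.
move=> /andP[v0 v1].
have mid : measurable_fun [set: measurableTypeR R] (id : measurableTypeR R -> R).
  by move=> _ A mA; rewrite setTI.
pose X : {RV (normal_prob (0 : R) 1) >-> R} := rv _ mid.
have [b vb] : exists b, v <= Phi b.
  have /fine_cvgP[_ /cvgrPdist_le] := cvg_cdfy1 X.
  have e0 : 0 < 1 - v by rewrite subr_gt0.
  move=> /(_ _ e0)[b [_ /(_ (b + 1))]] /=; rewrite ltrDl ltr01 => /(_ isT).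
  rewrite -[fine _]/(Phi (b + 1)) => H; exists (b + 1).
  have := le_trans (ler_norm _) H; lra.
have [a va] : exists a, Phi a <= v.
  have /fine_cvgP[_ /cvgrPdist_le] := cvg_cdfNy0 X.
  move=> /(_ _ v0)[a [_ /(_ (a - 1))]] /=; rewrite gtrBl ltr01 => /(_ isT).
  rewrite -[fine _]/(Phi (a - 1)) sub0r normrN => H; exists (a - 1).
  by apply: le_trans H; exact: ler_norm.
have [ab|ba] := leP a b.
  have cab : {within `[a, b], continuous (@Phi R)}.
    by apply: continuous_subspaceT; exact: continuous_Phi.
  have [|c _ <-] := @IVT _ _ _ _ v ab cab; last by exists c.
  by rewrite ge_min va/= le_max vb orbT.
exists a; apply/eqP; rewrite eq_le va/=; apply: (le_trans vb).
exact/Phi_ndec/ltW.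
Qed.

Lemma Phi_q (a : R) : 0 < a < 1 -> Phi (q a) = 1 - a / 2.
Proof.
move=> a01; rewrite /q pinvK// inE.
have [x <-] : exists x, Phi x = 1 - a / 2 by apply: Phi_onto; lra.
by exists x.
Qed.

Lemma q_gt0 (a : R) : 0 < a < 1 -> 0 < q a.
Proof.
move=> a01; rewrite ltNge; apply/negP => q0.
have := Phi_ndec q0; have := PhiN 0; rewrite oppr0 Phi_q//; lra.
Qed.

(** The endpoints move a little, from z to y in clt and from q a to z in
    confidence; by continuity of Phi this costs as little probability as
    wanted. *)
Lemma quantile_approx (a e : R) : 0 < a < 1 -> 0 < e ->
  exists y z, [/\ 0 <= y, y < z, z < q a &
    1 - fine (N01 `[- y, y]) <= a + e].
Proof.
move=> a01 e0; have q0 := q_gt0 a01.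
have p0 : 0 < normal_peak (1 : R) by rewrite normal_peak_gt0// oner_neq0.
pose t := Num.min (q a / 2) (e / (2 * normal_peak 1)).
have t0 : 0 < t.
  by rewrite lt_min; apply/andP; split; apply: divr_gt0 => //; exact: mulr_gt0.
have tq : t <= q a / 2 by rewrite ge_min lexx.
exists (q a - t), (q a - t / 2); split; [lra|lra|lra|].
rewrite Phi_itv; last by lra.
rewrite PhiN; have := Phi_lipschitz (q a) (q a - t); rewrite Phi_q//.
have -> : q a - (q a - t) = t by ring.
rewrite (gtr0_norm t0) => H.
have : normal_peak 1 * t <= e / 2.
  have : t <= e / (2 * normal_peak 1) by rewrite ge_min lexx orbT.
  rewrite ler_pdivlMr ?mulr_gt0//; lra.
have := le_trans (ler_norm _) H; lra.
Qed.

End gaussian_quantile.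

(** * The pick-freeze statistic *)
Lemma mean_sqr_eq0 d (T : measurableType d) (R : realType) (P : probability T R)
    (f : T -> R) :
  measurable_fun setT f -> itg P (fun w => f w ^+ 2) ->
  \int[P]_w (f w ^+ 2) = 0 ->
  exists2 B, measurable B & P B = 0%E /\ forall w, ~ B w -> f w = 0.
Proof.
move=> mf i2 e2.
have := @ae_eq_integral_abs _ _ _ P setT measurableT (fun w => (f w ^+ 2)%:E).
case=> [|H _]; first exact: measurable_int i2.
have [|B [mB B0 BN]] := H.
  under eq_integral do rewrite /= ger0_norm ?sqr_ge0//.
  by rewrite mean_EFin// e2.
exists B => //; split=> // w Bw; apply: contrapT => fw; apply/Bw/BN => /= H0.
apply: fw; apply/eqP; rewrite -sqrf_eq0.
by have := H0 I => -[->].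
Qed.

(** Changing a sequence on events whose probability tends to 0 does not change
    its limit in probability. *)
Lemma to_prob_off d (T : measurableType d) (R : realType) (P : probability T R)
    (u v : nat -> T -> R) (c : R) (E : nat -> set T) :
  asymp_le P E 0 -> (\forall N \near \oo, forall w, ~ E N w -> u N w = v N w) ->
  to_prob P u c -> to_prob P v c.
Proof.
move=> E0 uv uc e e0; apply: asymp_le_near (asymp_leU0 (uc e e0) E0).
apply: filterS uv => N uv w /= ev.
have [Ew|nEw] := pselect (E N w); [by right|left].
by rewrite (uv _ nEw).
Qed.

Section pick_freeze_algebra.
Context {R : realType} (n : nat).
Variables (y y' : 'I_n -> R) (m S : R).

Definition centered_mean := n%:R^-1 * \sum_(i < n) ((y i + y' i) / 2 - m).

Definition centered_den :=
  n%:R^-1 * \sum_(i < n) (((y i - m) ^+ 2 + (y' i - m) ^+ 2) / 2)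
  - centered_mean ^+ 2.

Definition linear_part i :=
  (y i - m) * (y' i - m) - S * ((y i - m) ^+ 2 + (y' i - m) ^+ 2) / 2.

(** The statistic is invariant under translation of the outputs, so m may be
    their mean; then every term but linear_part is quadratic in averages of
    centred variables, hence negligible. *)
Lemma pick_freeze_centered : (0 < n)%N -> centered_den != 0 ->
  pick_freeze y y' - S =
  (n%:R^-1 * (\sum_(i < n) linear_part i) - (1 - S) * centered_mean ^+ 2) / centered_den.
Proof.
move=> n0; have nn0 : n%:R != 0 :> R by rewrite pnatr_eq0 -lt0n.
pose s1 := \sum_(i < n) (y i + y' i) / 2.
pose s2 := \sum_(i < n) y i * y' i.
pose s3 := \sum_(i < n) (y i ^+ 2 + y' i ^+ 2) / 2.
have sm : \sum_(i < n) m ^+ 2 = n%:R * m ^+ 2.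
  by rewrite sumr_const card_ord -[LHS]mulr_natl.
have e1 : \sum_(i < n) ((y i + y' i) / 2 - m) = s1 - n%:R * m.
  by rewrite sumrB sumr_const card_ord -[m *+ _]mulr_natl.
have e3 : \sum_(i < n) (((y i - m) ^+ 2 + (y' i - m) ^+ 2) / 2)
    = s3 - 2 * m * s1 + n%:R * m ^+ 2.
  rewrite -sm /s3 /s1 mulr_sumr -sumrB -big_split /=.
  by apply: eq_bigr => i _; field.
have e2 : \sum_(i < n) linear_part i =
    (s2 - 2 * m * s1 + n%:R * m ^+ 2) - S * (s3 - 2 * m * s1 + n%:R * m ^+ 2).
  rewrite -e3 -sm /s2 /s1 !mulr_sumr -!sumrB -big_split /= -sumrB.
  by apply: eq_bigr => i _; rewrite /linear_part; field.
rewrite /centered_den /centered_mean e1 e3 => d0.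
rewrite /pick_freeze e2 -/s1 -/s2 -/s3.
have -> : n%:R^-1 * s3 - (n%:R^-1 * s1) ^+ 2 =
  n%:R^-1 * (s3 - 2 * m * s1 + n%:R * m ^+ 2) - (n%:R^-1 * (s1 - n%:R * m)) ^+ 2.
  by field.
apply: (mulIf d0); rewrite mulrBl !divfK//; by field.
Qed.

End pick_freeze_algebra.

(** What the asymptotics need of the outputs Y and Y' of a model, written as
    functions a and b of the input W = (X, Z, Z'). *)
Record pick_freeze_pair d dU (T : measurableType d) (U : measurableType dU)
    (R : realType) (P : probability T R) (W : T -> U)
    (a b : U -> R) (m v S : R) : Prop := PickFreezePair {
  pair_meas1 : measurable_fun setT a;
  pair_meas2 : measurable_fun setT b;
  pair_sqr1 : itg P (fun w => (a (W w) - m) ^+ 2);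
  pair_sqr2 : itg P (fun w => (b (W w) - m) ^+ 2);
  pair_mean1 : \int[P]_w (a (W w) - m) = 0;
  pair_mean2 : \int[P]_w (b (W w) - m) = 0;
  pair_var1 : \int[P]_w ((a (W w) - m) ^+ 2) = v;
  pair_var2 : \int[P]_w ((b (W w) - m) ^+ 2) = v;
  pair_var_gt0 : 0 < v;
  pair_cov : \int[P]_w ((a (W w) - m) * (b (W w) - m)) = S * v }.

Section pick_freeze_asymptotics.
Context d dU (T : measurableType d) (U : measurableType dU) (R : realType)
  (P : probability T R) (n : nat -> nat).
Variables (xi : forall N, 'I_(n N) -> {RV P >-> U}) (W : {RV P >-> U}).
Arguments xi : clear implicits.
Hypothesis iid : forall N, iid_copies P (fun i => xi N i : T -> U) W.
Hypothesis noo : n N @[N --> \oo] --> \oo.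
Variables (a b : U -> R) (m v S : R).
Hypothesis H : pick_freeze_pair P W a b m v S.

Let ma : measurable_fun setT a. Proof. by case: H. Qed.
Let mb : measurable_fun setT b. Proof. by case: H. Qed.
Let a2 : itg P (fun w => (a (W w) - m) ^+ 2). Proof. by case: H. Qed.
Let b2 : itg P (fun w => (b (W w) - m) ^+ 2). Proof. by case: H. Qed.
Let am : \int[P]_w (a (W w) - m) = 0. Proof. by case: H. Qed.
Let bm : \int[P]_w (b (W w) - m) = 0. Proof. by case: H. Qed.
Let av : \int[P]_w ((a (W w) - m) ^+ 2) = v. Proof. by case: H. Qed.
Let bv : \int[P]_w ((b (W w) - m) ^+ 2) = v. Proof. by case: H. Qed.
Let v0 : 0 < v. Proof. by case: H. Qed.
Let abS : \int[P]_w ((a (W w) - m) * (b (W w) - m)) = S * v.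
Proof. by case: H. Qed.

(** The variable A - B / 2 of the statement, as a function of the input. *)
Definition first_order u :=
  (a u - m) * (b u - m) - S * ((a u - m) ^+ 2 + (b u - m) ^+ 2) / 2.
Hypothesis lin2 : itg P (fun w => first_order (W w) ^+ 2).

Let Y N w i := a (xi N i w).
Let Y' N w i := b (xi N i w).
Arguments Y : clear implicits.
Arguments Y' : clear implicits.

Let mam : measurable_fun setT (fun u => a u - m).
Proof. by apply: measurable_funB => //; exact: measurable_cst. Qed.
Let mbm : measurable_fun setT (fun u => b u - m).
Proof. by apply: measurable_funB => //; exact: measurable_cst. Qed.
Let mamW : measurable_fun setT (fun w => a (W w) - m).
Proof. exact: (measurableT_comp mam). Qed.
Let mbmW : measurable_fun setT (fun w => b (W w) - m).
Proof. exact: (measurableT_comp mbm). Qed.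

Lemma measurable_first_order : measurable_fun setT first_order.
Proof.
apply: measurable_funB; first exact: measurable_funM.
apply: measurable_funM => //; apply: measurable_funM => //.
by apply: measurable_funD; exact: measurable_funX.
Qed.

Lemma first_order_mean0 : \int[P]_w first_order (W w) = 0.
Proof.
have iab := itg_mul mamW mbmW a2 b2.
have is_ := itgZ (S / 2) (itgD a2 b2).
under eq_Rintegral do rewrite /first_order mulrAC.
by rewrite meanB// meanZ; [rewrite meanD// av bv abS; field|exact: itgD].
Qed.

(** The average of the two centred outputs. *)
Let half u := (a u + b u) / 2 - m.

Let mhalf : measurable_fun setT half.
Proof.
apply: measurable_funB => //; apply: measurable_funM => //.
exact: measurable_funD.
Qed.

Let halfE u : half u = 2^-1 * ((a u - m) + (b u - m)).
Proof. by rewrite /half; field. Qed.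

Let half1 : itg P (fun w => half (W w)) /\ \int[P]_w half (W w) = 0.
Proof.
have ia := itg_sqr mamW a2; have ib := itg_sqr mbmW b2.
split; first by apply: (eq_itg (itgZ 2^-1 (itgD ia ib))) => w; rewrite halfE.
under eq_Rintegral do rewrite halfE.
by rewrite meanZ; [rewrite meanD// am bm addr0 mulr0|exact: itgD].
Qed.

Let half2 : itg P (fun w => half (W w) ^+ 2).
Proof.
have iab := itg_mul mamW mbmW a2 b2.
apply: (eq_itg (itgZ 4^-1 (itgD (itgD a2 b2) (itgZ 2 iab)))) => w.
by rewrite halfE; field.
Qed.

Let cden N w := centered_den (Y N w) (Y' N w) m.
Let cmean N w := centered_mean (Y N w) (Y' N w) m.

Lemma cmean_to0 : to_prob P cmean 0.
Proof. by rewrite -half1.2; exact: (wlln iid noo mhalf half1.1). Qed.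

Lemma cden_tov : to_prob P cden v.
Proof.
have -> : v = v + -1 * 0 by rewrite mulr0 addr0.
apply: (@to_prob_near _ _ _ _
    (fun N w => (n N)%:R^-1 * \sum_(i < n N)
      (((a (xi N i w) - m) ^+ 2 + (b (xi N i w) - m) ^+ 2) / 2)
      + -1 * (cmean N w * cmean N w))).
  by apply: nearW => N w; rewrite /cden /centered_den expr2 mulN1r.
apply: to_probD; last first.
  apply: to_probZ; apply: tight_mul0; last exact: cmean_to0.
  exact: to_prob_tight cmean_to0.
have e : \int[P]_w (((a (W w) - m) ^+ 2 + (b (W w) - m) ^+ 2) / 2) = v.
  under eq_Rintegral do rewrite mulrC.
  by rewrite meanZ; [rewrite meanD// av bv; field|exact: itgD].
rewrite -[X in to_prob _ _ X]e.
apply: (@wlln _ _ _ _ _ _ _ _ _ iid noo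
  (fun u => ((a u - m) ^+ 2 + (b u - m) ^+ 2) / 2)).
  by apply: measurable_funM => //; apply: measurable_funD; exact: measurable_funX.
by apply: (eq_itg (itgZ 2^-1 (itgD a2 b2))) => w; rewrite mulrC.
Qed.

Let cden0 : asymp_le P (fun N => [set w | cden N w = 0]) 0.
Proof.
apply: asymp_le_sub (cden_tov v0) => N w /= ->.
by rewrite sub0r normrN ler_norm.
Qed.

Let PF N w := pick_freeze (Y N w) (Y' N w).

(** The delta method. After pick_freeze_centered, the denominator tends to v
    and the quadratic term is a bounded sequence in probability times an
    average that tends to 0. *)
Theorem pick_freeze_linear :
  to_prob P (fun N w =>
    Num.sqrt (n N)%:R * (PF N w - S) - v^-1 * nsum xi first_order N w) 0.
Proof.
pose u N w := nsum xi first_order N w * ((cden N w)^-1 + - v^-1) +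
  - (1 - S) * ((cden N w)^-1 * (nsum xi half N w * cmean N w)).
apply: (@to_prob_off _ _ _ _ u _ _ _ cden0).
  apply: filterS (near_n_gt0 noo) => N n0 w /= /eqP d0.
  have nn0 : (n N)%:R != 0 :> R by rewrite pnatr_eq0 -lt0n.
  have s0 : Num.sqrt (n N)%:R != 0 :> R by rewrite gt_eqF// sqrtr_gt0 ltr0n.
  rewrite /PF (@pick_freeze_centered _ _ _ _ m)// -/(cden N w) -/(cmean N w).
  have sE : (n N)%:R^-1 = (Num.sqrt (n N)%:R)^-1 * (Num.sqrt (n N)%:R)^-1 :> R.
    by rewrite -invfM -expr2 sqr_sqrtr.
  have e1 : nsum xi first_order N w = (Num.sqrt (n N)%:R)^-1 *
    \sum_(i < n N) linear_part (Y N w) (Y' N w) m S i by [].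
  have e2 : (Num.sqrt (n N)%:R)^-1 * nsum xi half N w = cmean N w.
    by rewrite /cmean /centered_mean sE -mulrA.
  have e3 : nsum xi half N w = Num.sqrt (n N)%:R * cmean N w.
    by rewrite -e2 mulrA mulfV// mul1r.
  rewrite /u e3 e1 sE; field.
  by rewrite d0 s0 gt_eqF.
rewrite -[X in to_prob _ _ X]addr0; apply: to_probD.
  apply: tight_mul0.
    exact: (tight_nsum iid noo measurable_first_order lin2 first_order_mean0).
  rewrite -[X in to_prob _ _ X](subrr v^-1); apply: to_probD.
    by apply: to_prob_inv; [rewrite gt_eqF|exact: cden_tov].
  exact: to_prob_cst.
rewrite -[X in to_prob _ _ X](mulr0 (- (1 - S))); apply: to_probZ.
apply: tight_mul0.
  apply: (@to_prob_tight _ _ _ _ _ v^-1).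
  by apply: to_prob_inv; [rewrite gt_eqF|exact: cden_tov].
apply: tight_mul0; last exact: cmean_to0.
exact: (tight_nsum iid noo mhalf half2 half1.2).
Qed.

(** If the first-order term vanishes almost surely and S = 1, the remainder
    (1 - S) m^2 vanishes too: the estimator is exact as soon as its
    denominator is not 0. *)
Theorem pick_freeze_degenerate : S = 1 -> \int[P]_w (first_order (W w) ^+ 2) = 0 ->
  asymp_le P (fun N => [set w | PF N w <> 1]) 0.
Proof.
move=> S1 l0.
pose E N := [set w | nsum xi first_order N w <> 0].
have HE : asymp_le P E 0.
  move=> e e0; apply: filterS (near_n_gt0 noo) => N n0.
  have [i2 e2] := nsum_sqr iid measurable_first_order lin2 first_order_mean0 n0.
  have mS : measurable_fun setT (nsum xi first_order N).
    exact: measurable_nsum measurable_first_order N.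
  have [B mB [B0 BN]] := mean_sqr_eq0 mS i2 (etrans e2 l0).
  exists B => //; split; last by rewrite B0 lee_fin add0r ltW.
  by move=> w Ew; apply: contrapT => /BN.
apply: asymp_le_near (asymp_leU0 HE cden0).
apply: filterS (near_n_gt0 noo) => N n0 w /= PF1.
apply: contrapT => /not_orP[/contrapT l1 /eqP d0]; apply: PF1.
have s0 : Num.sqrt (n N)%:R != 0 :> R by rewrite gt_eqF// sqrtr_gt0 ltr0n.
have := pick_freeze_centered S n0 d0; rewrite S1 subrr mul0r subr0 -S1.
have -> : \sum_(i < n N) linear_part (Y N w) (Y' N w) m S i = 0.
  move: l1 => /eqP; rewrite /nsum mulf_eq0 invr_eq0 (negbTE s0) /= => /eqP.
  by [].
by rewrite mulr0 mul0r => /eqP; rewrite subr_eq0 => /eqP.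
Qed.

End pick_freeze_asymptotics.

(** * Conditional expectation given X *)
Definition aeq d (T : measurableType d) (R : realType) (P : probability T R)
  (f g : T -> R) :=
  exists2 B, measurable B & P B = 0%E /\ forall w, ~ B w -> f w = g w.

Section almost_sure.
Context d (T : measurableType d) (R : realType) (P : probability T R).

Lemma mean_aeq (f g : T -> R) : itg P f -> measurable_fun setT g -> aeq P f g ->
  itg P g /\ \int[P]_w g w = \int[P]_w f w.
Proof.
move=> fi mg [B mB [B0 fg]].
have ae : ae_eq P setT (EFin \o f) (EFin \o g).
  exists B; split=> // w /= H; apply: contrapT => nB; apply: H => _.
  by rewrite fg.
have mf := itg_meas fi.
have mfE : measurable_fun setT (EFin \o f) by exact/measurable_EFinP.
have mgE : measurable_fun setT (EFin \o g) by exact/measurable_EFinP.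
split; last by congr fine; apply/esym; exact: ae_eq_integral ae.
have /integrableP[_ flt] := fi; apply/integrableP; split=> //.
apply: le_lt_trans flt; rewrite le_eqVlt; apply/orP; left; apply/eqP/esym.
apply: ae_eq_integral => //; try exact: measurableT_comp.
exists B; split=> // w /= H; apply: contrapT => nB; apply: H => _.
by rewrite fg.
Qed.

Lemma aeqM (f g f' g' : T -> R) : aeq P f g -> aeq P f' g' ->
  aeq P (fun w => f w * f' w) (fun w => g w * g' w).
Proof.
move=> [B mB [B0 fg]] [C mC [C0 fg']]; exists (B `|` C); first exact: measurableU.
split; first by rewrite null_set_setU.
by move=> w /not_orP[h1 h2]; rewrite fg// fg'.
Qed.

End almost_sure.

Section fiber.
Context d dV dU (T : measurableType d) (V : measurableType dV)
  (U : measurableType dU) (R : realType) (P : probability T R).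
Variables (X : {RV P >-> V}) (Z : {RV P >-> U}).
Hypothesis XZ : independent2 P X Z.

(** The mean of k(x, Z) for a fixed x. *)
Definition fiber (k : V * U -> R) x : R :=
  (\int[distribution P Z]_z k (x, z))%R.

(** Fubini for the law of (X, Z). *)
Lemma mean_fiber (k : V * U -> R) : measurable_fun setT k ->
  (forall x, (distribution P Z).-integrable setT (fun z => (k (x, z))%:E)) ->
  itg P (fun w => k (X w, Z w)) ->
  [/\ measurable_fun setT (fiber k), itg P (fun w => fiber k (X w)) &
      \int[P]_w fiber k (X w) = \int[P]_w k (X w, Z w)].
Proof.
move=> mk ik ikP.
have [i2 e2] := mean_joint XZ mk ikP.
have kE x : (\int[distribution P Z]_z (k (x, z))%:E = (fiber k x)%:E)%E.
  rewrite /fiber /Rintegral fineK//; apply: integrable_fin_num => //; exact: ik.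
have iF := integrable_fubini_F i2.
have FE : fubini_F (distribution P Z) (EFin \o k) = EFin \o fiber k.
  by apply/funext => x; rewrite /fubini_F /= kE.
rewrite FE in iF.
have mf : measurable_fun setT (fiber k).
  by apply/measurable_EFinP; exact: measurable_int iF.
have ifP : itg P (fun w => fiber k (X w)).
  have /integrableP[_ flt] := iF; apply/integrableP; split.
    by apply/measurable_EFinP; exact: measurableT_comp.
  have mnf : measurable_fun setT (fun x => `|(fiber k x)%:E|%E).
    by apply: measurableT_comp => //; exact/measurable_EFinP.
  by have := @ge0_integral_distribution _ _ _ _ _ P X _ mnf (fun=> abse_ge0 _) => /= <-.
split=> //; apply/EFin_inj; rewrite e2.
under eq_integral do rewrite kE.
by rewrite -(mean_distribution mf ifP).2 /Rintegral fineK//; exact: integrable_fin_num.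
Qed.

End fiber.

Section cond_exp.
Context d dV dU (T : measurableType d) (V : measurableType dV)
  (U : measurableType dU) (R : realType) (P : probability T R).
Variables (X : {RV P >-> V}) (Z Z' : {RV P >-> U}).
Hypothesis XZ : independent2 P X Z.
Hypothesis ZZ' : same_law P Z' Z.
Hypothesis Z'XZ : independent2 P Z' (fun w => (X w, Z w)).

Let mXZ : measurable_fun setT (fun w => (X w, Z w)).
Proof. exact: measurable_fun_pair. Qed.
Let mXZ' : measurable_fun setT (fun w => (X w, Z' w)).
Proof. exact: measurable_fun_pair. Qed.
Let XZr := rv P mXZ.
Let XZ'r := rv P mXZ'.

Lemma indep_XZ' : independent2 P X Z'.
Proof.
move=> A B mA mB; have := Z'XZ mB (measurableX mA measurableT).
rewrite (_ : (fun w => (X w, Z w)) @^-1` _ = X @^-1` A); last first.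
  by apply/seteqP; split=> w /=; [case|].
by rewrite setIC muleC.
Qed.

Lemma indep_XZ_Z' : independent2 P XZr Z'.
Proof. by move=> A B mA mB; rewrite setIC muleC; exact: Z'XZ. Qed.

(** Both laws are the product of the law of X and of the law of Z. *)
Lemma same_law_pair : same_law P XZ'r XZr.
Proof.
move=> C mC.
rewrite -[LHS](joint_law indep_XZ' mC) -[RHS](joint_law XZ mC).
apply: product_measure_unique => // A B mA mB.
transitivity (distribution P X A * distribution P Z B)%E.
  exact: product_measure1E.
by congr (_ * _)%E; exact/esym/ZZ'.
Qed.

Lemma integral_Z' (k : U -> R) :
  (distribution P Z).-integrable setT (EFin \o k) ->
  (distribution P Z').-integrable setT (EFin \o k) /\
  (\int[distribution P Z']_z k z = \int[distribution P Z]_z k z)%R.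
Proof.
move=> /integrableP[mk klt]; split; last first.
  by congr fine; apply: eq_measure_integral => A mA _; exact: ZZ'.
apply/integrableP; split=> //; apply: le_lt_trans klt.
rewrite le_eqVlt; apply/orP; left; apply/eqP.
by apply: eq_measure_integral => A mA _; exact: ZZ'.
Qed.

Section integrable_fibers.
Variable f : V * U -> R.
Hypothesis mf : measurable_fun setT f.
Hypothesis fx : forall x, (distribution P Z).-integrable setT (fun z => (f (x, z))%:E).
Hypothesis fi : itg P (fun w => f (X w, Z w)).

Let g := fiber Z f.

(** The fiber mean g(X) has the defining property of a conditional
    expectation given X, tested against any c(X). *)
Lemma mean_fiber_mul (c : V -> R) : measurable_fun setT c ->
  itg P (fun w => c (X w) * f (X w, Z w)) ->
  itg P (fun w => c (X w) * g (X w)) /\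
  \int[P]_w (c (X w) * g (X w)) = \int[P]_w (c (X w) * f (X w, Z w)).
Proof.
move=> mc ci.
have mk : measurable_fun setT (fun v : V * U => c v.1 * f v).
  by apply: measurable_funM => //; exact: measurableT_comp.
have ik x : (distribution P Z).-integrable setT (fun z => (c x * f (x, z))%:E).
  exact: (integrableZl measurableT (c x) (fx x)).
have [_ i1 e1] := mean_fiber XZ mk ik ci.
have E x : fiber Z (fun v => c v.1 * f v) x = c x * g x.
  by rewrite /fiber /= RintegralZl//; exact: fx.
split; first by apply: (eq_itg i1) => w; rewrite E.
by rewrite -e1; apply: eq_Rintegral => w _; rewrite E.
Qed.

Lemma measurable_fiber : measurable_fun setT g.
Proof. by have [] := mean_fiber XZ mf fx fi. Qed.

(** Given X, the outputs f(X, Z) and f(X, Z') are independent with the same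
    conditional mean g(X). Concretely, Z' is integrated first, then Z. *)
Lemma mean_copies : itg P (fun w => f (X w, Z w) * f (X w, Z' w)) ->
  itg P (fun w => g (X w) * g (X w)) /\
  \int[P]_w (g (X w) * g (X w)) = \int[P]_w (f (X w, Z w) * f (X w, Z' w)).
Proof.
move=> ii.
pose k (v : (V * U) * U) := f v.1 * f (v.1.1, v.2).
have mk : measurable_fun setT k.
  apply: measurable_funM; first exact: measurableT_comp.
  apply: measurableT_comp => //; apply: measurable_fun_pair => //.
  exact: measurableT_comp.
have ik v : (distribution P Z').-integrable setT (fun z => (k (v, z))%:E).
  exact: (integrableZl measurableT (f v) (integral_Z' (fx v.1)).1).
have [_ i1 e1] := mean_fiber indep_XZ_Z' mk ik ii.
have E v : fiber Z' k v = g v.1 * f v.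
  rewrite /fiber /k /= RintegralZl//; last exact: (integral_Z' (fx v.1)).1.
  by rewrite (integral_Z' (fx v.1)).2 mulrC.
have i2 : itg P (fun w => g (X w) * f (X w, Z w)).
  by apply: (eq_itg i1) => w; rewrite E.
have [i3 ->] := mean_fiber_mul measurable_fiber i2.
by split=> //; rewrite -e1; apply: eq_Rintegral => w _; rewrite E.
Qed.

(** The mean of g(X)^2 is at least the square of the mean of g(X). *)
Lemma mean_copies_ge : itg P (fun w => f (X w, Z w) * f (X w, Z' w)) ->
  (\int[P]_w f (X w, Z w)) ^+ 2 <= \int[P]_w (f (X w, Z w) * f (X w, Z' w)).
Proof.
move=> ii; have [i1 <-] := mean_copies ii.
have [mg _ <-] := mean_fiber XZ mf fx fi.
apply: mean_sqr_le; first exact: measurableT_comp.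
exact: i1.
Qed.

(** D = G - g(X) has mean 0 on each event of the sigma-algebra of X, hence on
    {D >= 0} and on its complement, so the mean of |D| is 0. *)
Lemma cond_exp_fiber (G : T -> R) :
  is_cond_expectation P X (fun w => f (X w, Z w)) G ->
  aeq P G (fun w => g (X w)).
Proof.
move=> [mG iG eG].
have mg := measurable_fiber.
have [_ ig _] := mean_fiber XZ mf fx fi.
pose TX := g_sigma_algebra_preimageType X.
have mGX : measurable_fun [set: TX] (G : TX -> R).
  by move=> _ B mB; rewrite setTI; exact: mG.
have mgX : measurable_fun [set: TX] (fun w : TX => g (X w)).
  move=> _ B mB; rewrite setTI; exists (g @^-1` B); last by rewrite setTI.
  by rewrite -[X in measurable X]setTI; exact: mg.
pose D w := G w - g (X w).
have iD : itg P D by exact: itgB.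
have mDX : measurable_fun [set: TX] (D : TX -> R) by exact: measurable_funB.
have D0 C : measurable C -> \int[P]_w (\1_C (X w) * D w) = 0.
  move=> mC; pose c x : R := \1_C x.
  have mc : measurable_fun setT c by exact: measurable_indic.
  have mcX : measurable_fun setT (fun w => c (X w)) by exact: measurableT_comp.
  have mul_itg (u : T -> R) : itg P u -> itg P (fun w => c (X w) * u w).
    move=> iu; apply: (itg_le _ _ (itg_norm iu)).
      by apply: measurable_funM => //; exact: itg_meas iu.
    by move=> w; rewrite normrM ler_piMl// /c indicE ger0_norm// lern1 leq_b1.
  have mul_int (u : T -> R) : itg P u ->
      (\int[P]_w (c (X w) * u w))%:E = (\int[P]_(w in X @^-1` C) (u w)%:E)%E.
    move=> iu; rewrite -mean_EFin; last exact: mul_itg.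
    rewrite [RHS]integral_mkcond; apply: eq_integral => w _.
    rewrite patchE /c indicE.
    rewrite -[w \in X @^-1` C]/(X w \in C).
    by case: (X w \in C); rewrite ?mul1r ?mul0r.
  have [_ eg] := mean_fiber_mul mc (mul_itg _ fi).
  under eq_Rintegral do rewrite mulrBr.
  rewrite meanB; [|exact: mul_itg|exact: mul_itg].
  rewrite eg; apply/eqP; rewrite subr_eq0; apply/eqP/EFin_inj.
  rewrite !mul_int//; apply: eG.
  by exists C => //; rewrite setTI.
have [C mC CE] : exists2 C, measurable C & forall w, C (X w) <-> 0 <= D w.
  have : measurable [set w : TX | 0 <= D w].
    by rewrite -[X in measurable X]setTI; apply: measurable_fun_le.
  move=> [C mC CE]; exists C => // w.
  have : ([set: T] `&` X @^-1` C) w <-> 0 <= D w by rewrite CE.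
  by rewrite setTI.
have absD w : `|D w| = 2 * (\1_C (X w) * D w) - 1 * D w.
  rewrite indicE mul1r; have [Dw|Dw] := leP 0 (D w).
    by rewrite ger0_norm// mem_set ?CE// mul1r; ring.
  rewrite ltr0_norm// memNset; first by rewrite mul0r mulr0 sub0r.
  by rewrite CE; apply/negP; rewrite -ltNge.
have e1 : \int[P]_w `|D w| = 0.
  have i1 : itg P (fun w => \1_C (X w) * D w).
    have := itgZ 2^-1 (itgD (itg_norm iD) iD); move=> /eq_itg; apply=> w.
    by rewrite absD; field.
  under eq_Rintegral do rewrite absD.
  rewrite meanB ?meanZ//; [|exact: itgZ|exact: itgZ].
  rewrite (D0 _ mC) mulr0 sub0r mul1r.
  have := D0 setT measurableT; rewrite indicT.
  by under eq_Rintegral do rewrite /= mul1r; move=> ->; rewrite oppr0.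
have [H _] := @ae_eq_integral_abs _ _ _ P setT measurableT (EFin \o D)
   (measurable_int _ iD).
have [|B [mB B0 BN]] := H.
  by rewrite (mean_EFin (itg_norm iD)) e1.
exists B => //; split=> // w Bw; apply: contrapT => Gg; apply/Bw/BN => /= H0.
apply: Gg; apply/eqP; rewrite -subr_eq0; apply/eqP.
by have := H0 I => -[].
Qed.

End integrable_fibers.

End cond_exp.

(** * Two outputs that share the input X *)
Section variance.
Context d (T : measurableType d) (R : realType) (P : probability T R).

Lemma covE (f g : T -> R) : cov P f g =
  \int[P]_w ((f w - \int[P]_w f w) * (g w - \int[P]_w g w)).
Proof. by rewrite /cov !unlock. Qed.

Lemma varE (f : T -> R) : var P f = \int[P]_w ((f w - \int[P]_w f w) ^+ 2).
Proof. by rewrite -[LHS]/(cov P f f) covE. Qed.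

(** A covariance that is finite is the integral of an integrable function. *)
Lemma covariance_itg (f g : T -> R) :
  measurable_fun setT f -> measurable_fun setT g ->
  covariance P f g \is a fin_num ->
  itg P (fun w => (f w - \int[P]_w f w) * (g w - \int[P]_w g w)).
Proof.
move=> mf mg; rewrite !unlock => H.
set h := fun w => _; have mh : measurable_fun setT (EFin \o h).
  by apply/measurable_EFinP; apply: measurable_funM;
    apply: measurable_funB => //; exact: measurable_cst.
have H' : (\int[P]_w (h w)%:E)%E \is a fin_num by [].
apply/integrableP; split=> //; apply/abse_integralP => //.
by rewrite -ge0_fin_numE// abse_fin_num.
Qed.

Lemma variance_itg (f : T -> R) : measurable_fun setT f ->
  'V_P[f] \is a fin_num -> itg P (fun w => (f w - \int[P]_w f w) ^+ 2).
Proof. by move=> mf /(covariance_itg mf mf). Qed.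

End variance.

Section conditional_copies.
Context d dV dU (T : measurableType d) (V : measurableType dV)
  (U : measurableType dU) (R : realType) (P : probability T R).
Variables (X : {RV P >-> V}) (Z Z' : {RV P >-> U}).
Hypothesis XZ : independent2 P X Z.
Hypothesis ZZ' : same_law P Z' Z.
Hypothesis Z'XZ : independent2 P Z' (fun w => (X w, Z w)).

(** By Fubini almost every fiber of f is integrable; setting f to 0 on the
    others makes the lemmas on integrable fibers applicable. *)
Lemma fiber_truncation (f : V * U -> R) : measurable_fun setT f ->
  itg P (fun w => f (X w, Z w)) ->
  exists f1 : V * U -> R, [/\ measurable_fun setT f1,
    forall x, (distribution P Z).-integrable setT (fun z => (f1 (x, z))%:E),
    aeq P (fun w => f (X w, Z w)) (fun w => f1 (X w, Z w)) &
    aeq P (fun w => f (X w, Z' w)) (fun w => f1 (X w, Z' w))].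
Proof.
move=> mf fi; have [i2 _] := mean_joint XZ mf fi.
have [N [mN N0 NP]] := ae_integrable1 i2.
pose f1 v := f v * \1_(~` N) v.1.
have mNC : measurable (~` N) by exact: measurableC.
have mXN : measurable (X @^-1` N) by exact: measurable_funPTI.
exists f1; split.
- apply: measurable_funM => //.
  have m1 : measurable_fun setT (\1_(~` N) : V -> R) by exact: measurable_indic.
  exact: (measurableT_comp m1).
- move=> x; rewrite /f1 /= indicE in_setC; have [xN|xN] := boolP (x \in N).
    apply: (@eq_integrable _ _ _ _ _ measurableT (cst 0%E)); last exact: integrable0.
    by move=> z _; rewrite /= mulr0.
  apply: (@eq_integrable _ _ _ _ _ measurableT (fun z => (f (x, z))%:E)).
    by move=> z _; rewrite /= mulr1.
  by apply: contrapT => nI; move/negP: xN; apply; rewrite inE; apply: NP.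
- exists (X @^-1` N) => //; split=> // w /= wN.
  by rewrite /f1 /= indicE in_setC memNset ?mulr1.
- exists (X @^-1` N) => //; split=> // w /= wN.
  by rewrite /f1 /= indicE in_setC memNset ?mulr1.
Qed.

Lemma copy_itg (F : V * U -> R) : measurable_fun setT F ->
  itg P (fun w => F (X w, Z w)) ->
  itg P (fun w => F (X w, Z' w)) /\
  \int[P]_w F (X w, Z' w) = \int[P]_w F (X w, Z w).
Proof.
move=> mF iF.
have mXZ : measurable_fun setT (fun w => (X w, Z w)) by exact: measurable_fun_pair.
have mXZ' : measurable_fun setT (fun w => (X w, Z' w)) by exact: measurable_fun_pair.
exact: (@same_law_itg _ _ _ _ _ P (rv P mXZ') (rv P mXZ) F
  (same_law_pair XZ ZZ' Z'XZ) mF iF).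
Qed.

Variables (f : V * U -> R) (m : R).
Hypothesis mf : measurable_fun setT f.
Let k v := f v - m.
Let mk : measurable_fun setT k.
Proof. by apply: measurable_funB => //; exact: measurable_cst. Qed.
Let mkZ : measurable_fun setT (fun w => k (X w, Z w)).
Proof. by apply: measurableT_comp => //; exact: measurable_fun_pair. Qed.
Let mkZ' : measurable_fun setT (fun w => k (X w, Z' w)).
Proof. by apply: measurableT_comp => //; exact: measurable_fun_pair. Qed.
Hypothesis k2 : itg P (fun w => k (X w, Z w) ^+ 2).
Hypothesis k0 : \int[P]_w k (X w, Z w) = 0.

Let k2' : itg P (fun w => k (X w, Z' w) ^+ 2) /\
  \int[P]_w (k (X w, Z' w) ^+ 2) = \int[P]_w (k (X w, Z w) ^+ 2).
Proof. by apply: (copy_itg (F := fun v => k v ^+ 2)) => //; exact: measurable_funX. Qed.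

Let ikk : itg P (fun w => k (X w, Z w) * k (X w, Z' w)).
Proof. by apply: itg_mul => //; exact: k2'.1. Qed.

(** The identity behind pick-freeze estimation: the variance of E(Y|X) is
    the covariance of Y and Y', because E(Y Y'|X) = E(Y|X)^2. *)
Theorem variance_cond_exp (G : T -> R) :
  is_cond_expectation P X (fun w => f (X w, Z w)) G ->
  var P G = \int[P]_w (k (X w, Z w) * k (X w, Z' w)).
Proof.
move=> [mG iG eG].
have ki := itg_sqr mkZ k2.
have [k1 [mk1 k1x a1 a1']] := fiber_truncation mk ki.
have fi : itg P (fun w => f (X w, Z w)).
  by apply: (eq_itg (itgD ki (itg_cst P m))) => w; rewrite /k subrK.
have fm : \int[P]_w f (X w, Z w) = m.
  have := k0; rewrite /k meanB//; last exact: itg_cst.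
  by rewrite mean_cst => /eqP; rewrite subr_eq0 => /eqP.
have Gm : \int[P]_w G w = m.
  rewrite -fm /Rintegral; congr fine; apply: eG.
  by exists setT => //; rewrite setTI preimage_setT.
have m1 : measurable_fun setT (fun w => k1 (X w, Z w)).
  by apply: measurableT_comp => //; exact: measurable_fun_pair.
have m1' : measurable_fun setT (fun w => k1 (X w, Z' w)).
  by apply: measurableT_comp => //; exact: measurable_fun_pair.
have [i1 e1] := mean_aeq ki m1 a1.
have [ikk1 ekk1] := mean_aeq ikk (measurable_funM m1 m1') (aeqM a1 a1').
have H : is_cond_expectation P X (fun w => k1 (X w, Z w)) (fun w => G w - m).
  split.
  - move=> B mB.
    have -> : (fun w => G w - m) @^-1` B = G @^-1` ((fun x => x - m) @^-1` B) by [].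
    apply: mG; rewrite -[X in measurable X]setTI.
    have : measurable_fun setT (fun x : R => x - m).
      by apply: measurable_funB => //; exact: measurable_cst.
    exact.
  - exact: (itgB iG (itg_cst P m)).
  - move=> A XA.
    have mA : measurable A.
      by case: XA => C mC <-; rewrite setTI; exact: measurable_funPTI.
    have iA (u : T -> R) : itg P u -> P.-integrable A (EFin \o u).
      by move=> iu; apply: integrableS iu.
    have -> : (\int[P]_(w in A) (k1 (X w, Z w))%:E =
               \int[P]_(w in A) (k (X w, Z w))%:E)%E.
      apply: ae_eq_integral => //.
      - by have := measurable_int _ (iA _ i1).
      - by have := measurable_int _ (iA _ ki).
      - have [B mB [B0 BE]] := a1; exists B; split=> // w /= H0.
        by apply: contrapT => nB; apply: H0 => _; rewrite (BE _ nB).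
    transitivity (\int[P]_(w in A) ((G w)%:E - m%:E))%E; first by [].
    rewrite integralB_EFin//; [|exact: iA|exact: (iA _ (itg_cst P m))].
    rewrite eG//.
    rewrite -integralB_EFin//; [exact: (iA _ fi)|exact: (iA _ (itg_cst P m))].
have aG := cond_exp_fiber XZ mk1 k1x i1 H.
have [ig eg] := mean_copies XZ ZZ' Z'XZ mk1 k1x i1 ikk1.
rewrite varE Gm -ekk1 -eg.
have mGm : measurable_fun setT (fun w => G w - m).
  by apply: itg_meas; exact: (itgB iG (itg_cst P m)).
have [B mB [B0 BE]] := aG.
have mgX : measurable_fun setT (fun w => fiber Z k1 (X w)).
  by apply: measurableT_comp => //; exact: (measurable_fiber XZ mk1 k1x i1).
have a2 : aeq P (fun w => fiber Z k1 (X w) * fiber Z k1 (X w)) (fun w => (G w - m) ^+ 2).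
  by exists B => //; split=> // w Bw; rewrite -(BE _ Bw) expr2.
have m2 : measurable_fun setT (fun w => (G w - m) ^+ 2) by exact: measurable_funX.
by have [_ ->] := mean_aeq ig m2 a2.
Qed.

Variables (S v : R).
Hypothesis kv : \int[P]_w (k (X w, Z w) ^+ 2) = v.
Hypothesis v0 : 0 < v.
Hypothesis kS : \int[P]_w (k (X w, Z w) * k (X w, Z' w)) = S * v.
Hypothesis S0 : 0 <= S.

Let D w := k (X w, Z w) * k (X w, Z' w)
  - S * (k (X w, Z w) ^+ 2 + k (X w, Z' w) ^+ 2) / 2.

Lemma ratio_le1 : S <= 1.
Proof.
rewrite -(ler_pM2r v0) mul1r -kS.
have e : \int[P]_w (2^-1 * (k (X w, Z w) ^+ 2 + k (X w, Z' w) ^+ 2)) = v.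
  rewrite meanZ; last exact: itgD k2'.1.
  by rewrite meanD// ?k2'.1// k2'.2 kv; field.
rewrite -e; apply: mean_le => //; first by apply: itgZ; exact: itgD k2'.1.
move=> w; have := sqr_ge0 (k (X w, Z w) - k (X w, Z' w)); nra.
Qed.

Lemma measurable_annulus (a b : R) :
  measurable [set w | a <= `|k (X w, Z w)| <= b].
Proof.
rewrite (_ : [set w | _] =
    [set w | a <= `|k (X w, Z w)|] `&` [set w | `|k (X w, Z w)| <= b]); last first.
  by apply/seteqP; split=> u /= => [/andP//|[-> ->]].
have mnk : measurable_fun setT (fun w => `|k (X w, Z w)|) by exact: measurableT_comp.
by apply: measurableI; rewrite -[X in measurable X]setTI;
  apply: measurable_fun_le => //; exact: measurable_cst.
Qed.

(** On the event that k = k(X, Z) and k' = k(X, Z') both lie in the annulus,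
    k k' = S (k^2 + k'^2) / 2 is nonnegative, hence at least a^2, and at most
    S b^2: the event is null. By conditional independence given X its
    probability is at least the square of P(k in the annulus). *)
Lemma annulus_null (a b : R) : 0 < a -> S * b ^+ 2 < a ^+ 2 ->
  itg P (fun w => D w ^+ 2) -> \int[P]_w (D w ^+ 2) = 0 ->
  P [set w | a <= `|k (X w, Z w)| <= b] = 0%E.
Proof.
move=> a0 ab iD eD.
pose phi v : R := \1_[set v | a <= `|k v| <= b] v.
have mB : measurable [set v | a <= `|k v| <= b].
  rewrite (_ : [set v | _] = [set v | a <= `|k v|] `&` [set v | `|k v| <= b]); last first.
    by apply/seteqP; split=> u /= => [/andP//|[-> ->]].
  have mnk : measurable_fun setT (fun v => `|k v|) by exact: measurableT_comp.
  by apply: measurableI; rewrite -[X in measurable X]setTI;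
    apply: measurable_fun_le => //; exact: measurable_cst.
have mphi : measurable_fun setT phi by exact: measurable_indic.
have phib u : `|phi u| <= 1 by rewrite /phi indicE ger0_norm// lern1 leq_b1.
have phix x : (distribution P Z).-integrable setT (fun z => (phi (x, z))%:E).
  apply: (@itg_bounded _ _ _ (distribution P Z) (fun z => phi (x, z)) 1) => //.
  by apply: measurableT_comp => //; exact: measurable_fun_pair.
have mp : measurable_fun setT (fun w => phi (X w, Z w)).
  by apply: measurableT_comp => //; exact: measurable_fun_pair.
have mp' : measurable_fun setT (fun w => phi (X w, Z' w)).
  by apply: measurableT_comp => //; exact: measurable_fun_pair.
have ip : itg P (fun w => phi (X w, Z w)) by apply: itg_bounded => // w; exact: phib.
have ipp : itg P (fun w => phi (X w, Z w) * phi (X w, Z' w)).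
  apply: (@itg_bounded _ _ _ _ _ 1); first exact: measurable_funM.
  by move=> w; rewrite normrM -[leRHS]mulr1; exact: ler_pM.
have mD : measurable_fun setT D.
  apply: measurable_funB; first exact: measurable_funM.
  apply: measurable_funM => //; apply: measurable_funM => //.
  by apply: measurable_funD; exact: measurable_funX.
have [B mB' [B0 BN]] := mean_sqr_eq0 mD iD eD.
have pp0 : \int[P]_w (phi (X w, Z w) * phi (X w, Z' w)) = 0.
  have a0' : aeq P (fun=> 0) (fun w => phi (X w, Z w) * phi (X w, Z' w)).
    exists B => //; split=> // w Bw; apply/esym.
    rewrite /phi !indicE.
    have [|_] := boolP ((X w, Z w) \in _); last by rewrite mul0r.
    have [|_] := boolP ((X w, Z' w) \in _); last by rewrite mulr0.
    rewrite !inE /= => /andP[h1 h2] /andP[h3 h4]; exfalso.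
    have := BN _ Bw; rewrite /D; set x := k (X w, Z w) in h3 h4 *.
    set y := k (X w, Z' w) in h1 h2 *.
    have x2 := real_normK (num_real x); have y2 := real_normK (num_real y).
    rewrite -x2 -y2 => H0.
    have xy : a ^+ 2 <= `|x * y| by rewrite normrM expr2 ler_pM// ltW.
    have xb : `|x| ^+ 2 <= b ^+ 2.
      by rewrite ler_pXn2r ?nnegrE// (le_trans _ h4).
    have yb : `|y| ^+ 2 <= b ^+ 2.
      by rewrite ler_pXn2r ?nnegrE// (le_trans _ h2).
    have xyE : x * y = S * (`|x| ^+ 2 + `|y| ^+ 2) / 2 by lra.
    have xy0 : 0 <= x * y.
      by rewrite xyE divr_ge0// mulr_ge0// addr_ge0// sqr_ge0.
    have : S * (`|x| ^+ 2 + `|y| ^+ 2) <= S * (b ^+ 2 + b ^+ 2).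
      by rewrite ler_wpM2l// lerD.
    rewrite (ger0_norm xy0) xyE in xy; lra.
  by have [_ ->] := mean_aeq (itg_cst P 0) (measurable_funM mp mp') a0'; rewrite mean_cst.
have := mean_copies_ge XZ ZZ' Z'XZ mphi phix ip ipp.
rewrite pp0 => p2; have p0 : \int[P]_w phi (X w, Z w) = 0.
  by apply/eqP; rewrite -sqrf_eq0 eq_le p2 sqr_ge0.
rewrite -[X in P X]setIT -integral_indic//; last exact: measurable_annulus.
by rewrite -[RHS]/(0%:E) -p0 -mean_EFin.
Qed.

(** If S < 1, countably many annuli as in annulus_null cover all k <> 0: the
    annuli [j/n, (j+1)/n] for j at least some J, as (j+1)/j tends to 1. Hence
    k = 0 almost surely, against the positive variance. *)
Theorem degenerate_ratio :
  itg P (fun w => D w ^+ 2) -> \int[P]_w (D w ^+ 2) = 0 -> S = 1.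
Proof.
move=> iD eD; apply/eqP; rewrite eq_le ratio_le1 leNgt; apply/negP => S1.
have S1' : 0 < 1 - S by rewrite subr_gt0.
pose J := (Num.truncn (2 / (1 - S))).+1.
have HJ j : (J <= j)%N -> S * j.+1%:R ^+ 2 < j%:R ^+ 2.
  move=> Jj; have : 2 / (1 - S) < j%:R.
    by apply: (lt_le_trans (truncnS_gt _)); rewrite ler_nat.
  rewrite ltr_pdivrMr// -natr1; have : 0 <= j%:R :> R by []. nra.
pose E (nj : nat * nat) := [set w | (J + nj.2)%:R / nj.1.+1%:R <= `|k (X w, Z w)|
   <= (J + nj.2).+1%:R / nj.1.+1%:R].
have E0 nj : P.-negligible (E nj).
  apply/negligibleP.
    exact: measurable_annulus.
  apply: annulus_null => //.
    by rewrite divr_gt0// ltr0n.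
  rewrite !expr_div_n mulrA ltr_pM2r ?invr_gt0 ?exprn_gt0//.
  by apply: HJ; rewrite leq_addr.
have : P.-negligible (\bigcup_i if unpickle i is Some nj then E nj else set0).
  apply: negligible_bigcup => i; case: unpickle => [nj|]; first exact: E0.
  exact: negligible_set0.
move=> [B [mB B0 BN]].
have k00 : aeq P (fun=> 0) (fun w => k (X w, Z w) ^+ 2).
  exists B => //; split=> // w Bw; apply/esym/eqP; rewrite sqrf_eq0.
  apply: contrapT => /negP kn0; apply/Bw/BN.
  have nk : 0 < `|k (X w, Z w)| by rewrite normr_gt0.
  pose n := Num.truncn (J%:R / `|k (X w, Z w)|).
  pose x := `|k (X w, Z w)| * n.+1%:R.
  have x0 : 0 <= x by rewrite mulr_ge0.
  have Jx : (J <= Num.truncn x)%N.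
    rewrite truncn_ge_nat// /x mulrC -ler_pdivrMr//.
    by apply/ltW/truncnS_gt.
  exists (pickle (n, Num.truncn x - J)%N) => //; rewrite pickleK /E /= subnKC//.
  rewrite ler_pdivrMr// ler_pdivlMr// -/x truncn_le x0 /=.
  exact/ltW/truncnS_gt.
have [_] := mean_aeq (itg_cst P 0) (measurable_funX 2 mkZ) k00.
by rewrite mean_cst kv => v00; move: v0; rewrite v00 ltxx.
Qed.

End conditional_copies.

(** * Confidence intervals *)
Section liminf.
Context d (T : measurableType d) (R : realType) (P : probability T R).

Lemma limn_einf_ge (u : nat -> \bar R) (a : R) :
  (forall e, 0 < e -> \forall N \near \oo, ((a - e)%:E <= u N)%E) ->
  (a%:E <= limn_einf u)%E.
Proof.
move=> H; apply/lee_addgt0Pr => e e0; rewrite -leeBlDr// -EFinB.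
rewrite limn_einf_lim; apply: lime_ge; first exact: is_cvg_einfs.
have [N _ HN] := H e e0; exists N => // n /= Nn.
apply: le_ereal_inf_tmp => _ [k /= nk <-]; apply: HN => /=.
exact: leq_trans Nn nk.
Qed.

Lemma asymp_le_liminf (E : nat -> set T) (a : R) :
  (forall N, measurable (E N)) -> asymp_le P (fun N => ~` E N) a ->
  ((1 - a)%:E <= limn_einf (fun N => P (E N)))%E.
Proof.
move=> mE Ea; apply: limn_einf_ge => e e0; apply: filterS (Ea e e0) => N.
move=> [B mB [EB PB]].
have : (P (~` E N) <= (a + e)%:E)%E.
  apply: le_trans PB; apply: le_measure => //; rewrite inE//; exact: measurableC.
rewrite probability_setC//.
have : P (E N) \is a fin_num by rewrite fin_num_measure.
case: (P (E N)) => // r _; rewrite -EFinB !lee_fin; lra.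
Qed.

Lemma cvg_in_probability_to_prob (u : nat -> {RV P >-> R}) (c : R) :
  cvg_in_probability P (fun N => u N : T -> R) c ->
  to_prob P (fun N => u N : T -> R) c.
Proof.
move=> H e e0 t t0.
have /fine_cvgP[fu /cvgrPdist_le/(_ _ t0) H1] := H e e0; near=> N.
exists [set w | e <= `|u N w - c|].
  rewrite -[X in measurable X]setTI; apply: measurable_fun_le => //.
  apply: measurableT_comp => //; apply: measurable_funB => //.
split=> //; rewrite add0r.
have fP : P [set w | e <= `|u N w - c|] \is a fin_num by near: N.
rewrite -(fineK fP) lee_fin.
have : `|0 - fine (P [set w | e <= `|u N w - c|])| <= t by near: N.
by rewrite sub0r normrN; apply: le_trans; exact: ler_norm.
Unshelve. all: by end_near. Qed.

Lemma cvg_in_probability_cst (c : R) :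
  cvg_in_probability P (fun=> (rv P (@measurable_cst _ _ _ _ setT c) : T -> R)) c.
Proof.
move=> e e0; rewrite (_ : (fun n : nat => _) = fun=> 0%E); first exact: cvg_cst.
apply/funext => n; rewrite (_ : [set w | _] = set0) ?measure0//.
by apply/seteqP; split=> // w /=; rewrite subrr normr0 leNgt e0.
Qed.

End liminf.

(** The inverse is a power function on each half-line. *)
Lemma measurable_inv (R : realType) : measurable_fun setT (@GRing.inv R).
Proof.
rewrite (_ : @GRing.inv R =
  fun x : R => if 0 <= x then x `^ (-1) else - ((- x) `^ (-1))).
  apply: measurable_fun_ifT.
  - by apply: measurable_fun_ler.
  - exact: measurable_powR.
  - have mN : measurable_fun setT (fun x : R => - x) by exact: measurable_funN.
    have mp := @measurable_powR R (-1).
    by apply: measurable_funN; exact: (measurableT_comp mp mN).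
apply/funext => x; have [x0|x0] := leP 0 x; first by rewrite powR_inv1.
by rewrite powR_inv1 ?invrN ?opprK// oppr_ge0 ltW.
Qed.

Lemma measurable_pick_freeze d (T : measurableType d) (R : realType) (n : nat)
  (y y' : 'I_n -> T -> R) :
  (forall i, measurable_fun setT (y i)) -> (forall i, measurable_fun setT (y' i)) ->
  measurable_fun setT (fun w => pick_freeze (y^~ w) (y'^~ w)).
Proof.
move=> my my'.
have mm : measurable_fun setT (fun w => n%:R^-1 * \sum_(i < n) (y i w + y' i w) / 2).
  apply: measurable_funM => //; apply: measurable_sum => i.
  by apply: measurable_funM => //; exact: measurable_funD.
apply: measurable_funM; first apply: measurable_funB.
- apply: measurable_funM => //; apply: measurable_sum => i; exact: measurable_funM.
- exact: measurable_funX.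
- apply: measurableT_comp; first exact: measurable_inv.
  apply: measurable_funB; last exact: measurable_funX.
  apply: measurable_funM => //; apply: measurable_sum => i.
  by apply: measurable_funM => //; apply: measurable_funD; exact: measurable_funX.
Qed.

Lemma measurable_concat (R : realType) (p1 p2 : nat) :
  measurable_fun setT
    (fun v : p1.-tuple R * p2.-tuple R => concat v.1 v.2).
Proof.
apply/measurable_fun_tnthP => i.
have [j ->|j ->] := split_ordP i.
  rewrite (_ : _ \o _ = fun v : p1.-tuple R * p2.-tuple R => tnth v.1 j).
    exact: (measurableT_comp (measurable_tnth j) measurable_fst).
  by apply/funext => v /=; rewrite /concat tnth_lshift.
rewrite (_ : _ \o _ = fun v : p1.-tuple R * p2.-tuple R => tnth v.2 j).
  exact: (measurableT_comp (measurable_tnth j) measurable_snd).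
by apply/funext => v /=; rewrite /concat tnth_rshift.
Qed.

Section confidence.
Context d dU (T : measurableType d) (U : measurableType dU) (R : realType)
  (P : probability T R) (n : nat -> nat).
Variables (xi : forall N, 'I_(n N) -> {RV P >-> U}) (W : {RV P >-> U}).
Arguments xi : clear implicits.
Hypothesis iid : forall N, iid_copies P (fun i => xi N i : T -> U) W.
Hypothesis noo : n N @[N --> \oo] --> \oo.

(** Slutsky's theorem for the events of the theorem: if the error G is
    first-order equivalent to sigma times a normalized sum, replacing sigma by
    a consistent estimator costs no asymptotic probability. The room for the
    two errors of size eta is taken between z and q alpha. *)
Theorem confidence (h : U -> R) (G hs : nat -> T -> R) (sigma alpha : R) :
  measurable_fun setT h -> itg P (fun w => h (W w) ^+ 2) ->
  \int[P]_w h (W w) = 0 -> \int[P]_w (h (W w) ^+ 2) = 1 ->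
  0 < sigma ->
  to_prob P (fun N w => Num.sqrt (n N)%:R * G N w - sigma * nsum xi h N w) 0 ->
  to_prob P hs sigma -> 0 < alpha < 1 ->
  asymp_le P (fun N => [set w |
    ~ (`|G N w| <= q alpha * (hs N w / Num.sqrt (n N)%:R))]) alpha.
Proof.
move=> mh h2 h0 h1 s0 G0 hss a01; apply: asymp_le_lim => e e0.
have q0 := q_gt0 a01.
have [y [z [y0 yz zq Hyz]]] := quantile_approx a01 e0.
pose eta := (q alpha - z) * sigma / 2.
have eta0 : 0 < eta by rewrite divr_gt0// mulr_gt0// subr_gt0.
have etaq : 0 < eta / q alpha by rewrite divr_gt0.
have := asymp_leU0 (asymp_leU0 (asymp_le_ge Hyz
  (clt iid noo mh h2 h0 h1 y0 yz)) (G0 _ eta0)) (hss _ etaq).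
apply: asymp_le_near; apply: filterS (near_n_gt0 noo) => N n0 w /= H.
apply: contrapT => /not_orP[/not_orP[/negP H1 /negP H2] /negP H3]; apply: H.
rewrite -!ltNge in H1 H2 H3; rewrite subr0 in H2.
have r0 : 0 < Num.sqrt (n N)%:R :> R by rewrite sqrtr_gt0 ltr0n.
rewrite mulrA ler_pdivlMr// -[X in _ * X](gtr0_norm r0) -normrM mulrC.
move: H1 H2 H3; set g := Num.sqrt _ * G N w; set s := nsum xi h N w => H1 H2 H3.
rewrite ltr_pdivlMr// in H3.
have H4 : `|g| <= `|g - sigma * s| + sigma * `|s|.
  rewrite -{1}(subrK (sigma * s) g); apply: le_trans (ler_normD _ _) _.
  by rewrite normrM (gtr0_norm s0).
have H5 : sigma * `|s| < sigma * z by rewrite ltr_pM2l.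
have H6 : (sigma - hs N w) * q alpha < eta.
  apply: le_lt_trans H3; rewrite ler_pM2r// distrC; exact: ler_norm.
rewrite /eta in H2 H6; nra.
Qed.

End confidence.

Section pick_freeze_model.
Context d dV dU (T : measurableType d) (V : measurableType dV)
  (U : measurableType dU) (R : realType) (P : probability T R).
Variables (X : {RV P >-> V}) (Z Z' : {RV P >-> U}).
Hypothesis XZ : independent2 P X Z.
Hypothesis ZZ' : same_law P Z' Z.
Hypothesis Z'XZ : independent2 P Z' (fun w => (X w, Z w)).
Variable f : V * U -> R.
Hypothesis mf : measurable_fun setT f.

Definition output1 (u : V * U * U) := f u.1.
Definition output2 (u : V * U * U) := f (u.1.1, u.2).

Lemma measurable_output1 : measurable_fun setT output1.
Proof. exact: measurableT_comp. Qed.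

Lemma measurable_output2 : measurable_fun setT output2.
Proof.
apply: measurableT_comp => //; apply: measurable_fun_pair => //.
exact: measurableT_comp.
Qed.

(** To be applied to eta and to etac. *)
Lemma pick_freeze_pair_outputs (G : T -> R) :
  'V_P[(fun w => f (X w, Z w))] \is a fin_num ->
  'V_P[(fun w => f (X w, Z w))] <> 0%E ->
  is_cond_expectation P X (fun w => f (X w, Z w)) G ->
  pick_freeze_pair P (fun w => (X w, Z w, Z' w)) output1 output2
    (fine 'E_P[fun w => f (X w, Z w)]) (var P (fun w => f (X w, Z w)))
    (var P G / var P (fun w => f (X w, Z w))).
Proof.
set Y := fun w => f (X w, Z w) => vfin vn0 hG.
have -> : fine 'E_P[Y] = \int[P]_w Y w by rewrite unlock.
set m := \int[P]_w Y w; pose k v := f v - m.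
have mY : measurable_fun setT Y.
  by apply: measurableT_comp => //; exact: measurable_fun_pair.
have mk : measurable_fun setT k.
  by apply: measurable_funB => //; exact: measurable_cst.
have mk2 : measurable_fun setT (fun v => k v ^+ 2) by exact: measurable_funX.
have mYm : measurable_fun setT (fun w => Y w - m).
  by apply: measurable_funB => //; exact: measurable_cst.
have v0 : 0 < var P Y.
  rewrite lt_neqAle eq_sym /var fine_ge0 ?variance_ge0// andbT.
  by rewrite fine_eq0//; apply/eqP.
have i2 : itg P (fun w => (Y w - m) ^+ 2) by exact: variance_itg.
have i1 := itg_sqr mYm i2.
have iY : itg P Y by apply: (eq_itg (itgD i1 (itg_cst P m))) => w; rewrite subrK.
have e1 : \int[P]_w (Y w - m) = 0.
  by rewrite meanB//; [rewrite mean_cst subrr|exact: itg_cst].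
have [i2' e2'] := copy_itg XZ ZZ' Z'XZ mk2 i2.
have [_ e1'] := copy_itg XZ ZZ' Z'XZ mk i1.
split => //.
- exact: measurable_output1.
- exact: measurable_output2.
- by rewrite -[LHS]/(\int[P]_w k (X w, Z' w)) e1'.
- by rewrite varE.
- by rewrite -[LHS]/(\int[P]_w (k (X w, Z' w) ^+ 2)) e2' varE.
- rewrite divfK ?gt_eqF//; apply/esym.
  exact: (variance_cond_exp XZ ZZ' Z'XZ mf i2 e1 hG).
Qed.

End pick_freeze_model.

Lemma var_ge0 d (T : measurableType d) (R : realType) (P : probability T R)
  (f : T -> R) : 0 <= var P f.
Proof. by rewrite /var fine_ge0// variance_ge0. Qed.

Lemma measurable_pick_freeze_of d (T : measurableType d) (R : realType)
    (P : probability T R) (p1 p2 n : nat) (f : {mfun (p1 + p2).-tuple R >-> R})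
    (xi : 'I_n -> {RV P >-> (p1.-tuple R * p2.-tuple R * p2.-tuple R)%type}) :
  measurable_fun setT (fun w => pick_freeze_of f (fun i => xi i w)).
Proof.
have mf : measurable_fun setT
    (fun v : p1.-tuple R * p2.-tuple R => f (concat v.1 v.2)).
  by apply: measurableT_comp => //; exact: measurable_concat.
apply: measurable_pick_freeze => i.
- exact: (measurableT_comp (measurable_output1 mf) (measurable_funPT (xi i))).
- exact: (measurableT_comp (measurable_output2 mf) (measurable_funPT (xi i))).
Qed.

Lemma measurable_pair_products d dU (T : measurableType d) (U : measurableType dU)
    (R : realType) (P : probability T R) (W : {RV P >-> U}) (a b : U -> R) (m v S : R) :
  pick_freeze_pair P W a b m v S ->
  measurable_fun setT (fun w => (a (W w) - m) * (b (W w) - m)) /\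
  measurable_fun setT (fun w => S * ((a (W w) - m) ^+ 2 + (b (W w) - m) ^+ 2)).
Proof.
move=> H.
have ma : measurable_fun setT (fun w => a (W w) - m).
  apply: measurable_funB => //; apply: measurableT_comp => //; exact: pair_meas1 H.
have mb : measurable_fun setT (fun w => b (W w) - m).
  apply: measurable_funB => //; apply: measurableT_comp => //; exact: pair_meas2 H.
split; first exact: measurable_funM.
by apply: measurable_funM => //; apply: measurable_funD; exact: measurable_funX.
Qed.

Lemma mean_pair_squares d dU (T : measurableType d) (U : measurableType dU)
    (R : realType) (P : probability T R) (W : {RV P >-> U}) (a b : U -> R) (m v S : R) :
  pick_freeze_pair P W a b m v S ->
  \int[P]_w (S * ((a (W w) - m) ^+ 2 + (b (W w) - m) ^+ 2)) = 2 * (S * v).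
Proof.
case=> _ _ a2 b2 _ _ av bv _ _.
by rewrite meanZ; [rewrite meanD// av bv; ring|exact: itgD].
Qed.

(** * The reduced estimator *)
Theorem theorem1p1 (R : realType) (d : measure_display) (T : measurableType d)
  (P : probability T R) (p1 p2 : nat)
  (eta etac : {mfun (p1 + p2).-tuple R >-> R})
  (X : {RV P >-> p1.-tuple R}) (Z Z' : {RV P >-> p2.-tuple R})
  (EYX EYcX : T -> R) (sigmac sigmae : R) (psi : nat -> nat)
  (s : forall N, 'I_N ->
         {RV P >-> (p1.-tuple R * p2.-tuple R * p2.-tuple R)%type})
  (t : forall N, 'I_(psi N) ->
         {RV P >-> (p1.-tuple R * p2.-tuple R * p2.-tuple R)%type}) :
  let Y w := eta (concat (X w) (Z w)) in
  let Y' w := eta (concat (X w) (Z' w)) in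
  let Yc w := etac (concat (X w) (Z w)) in
  let Yc' w := etac (concat (X w) (Z' w)) in
  let S := var P EYX / var P Y in
  let Sc := var P EYcX / var P Yc in
  let mY := fine 'E_P[Y] in
  let mYc := fine 'E_P[Yc] in
  let A w := (Y w - mY) * (Y' w - mY) in
  let B w := S * ((Y w - mY) ^+ 2 + (Y' w - mY) ^+ 2) in
  let Ac w := (Yc w - mYc) * (Yc' w - mYc) in
  let Bc w := Sc * ((Yc w - mYc) ^+ 2 + (Yc' w - mYc) ^+ 2) in
  let D w := A w - B w / 2 in
  let Dc w := Ac w - Bc w / 2 in
  let V N w := reduced_estimator eta etac
                 (fun i => s N i w) (fun i => t N i w) in
  independent2 P X Z ->
  same_law P Z' Z ->
  independent2 P Z' (fun w => (X w, Z w)) ->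
  'V_P[Y] \is a fin_num -> 'V_P[Y] <> 0%E ->
  'V_P[Yc] \is a fin_num -> 'V_P[Yc] <> 0%E ->
  is_cond_expectation P X Y EYX ->
  is_cond_expectation P X Yc EYcX ->
  'V_P[D] \is a fin_num -> 'V_P[Dc] \is a fin_num ->
  covariance P A Ac \is a fin_num -> covariance P A Bc \is a fin_num ->
  covariance P B Ac \is a fin_num -> covariance P B Bc \is a fin_num ->
  0 <= sigmac ->
  sigmac ^+ 2 = var P Dc / var P Yc ^+ 2 ->
  0 < sigmae ->
  sigmae ^+ 2 = sigmac ^+ 2 + var P D / var P Y ^+ 2
    - (2 * cov P A Ac - (cov P A Bc + cov P B Ac) + cov P B Bc / 2)
      / (var P Y * var P Yc) ->
  psi N @[N --> \oo] --> \oo ->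
  (forall N, iid_copies P (fun i => s N i : T -> _)
                          (fun w => (X w, Z w, Z' w))) ->
  (forall N, iid_copies P (fun i => t N i : T -> _)
                          (fun w => (X w, Z w, Z' w))) ->
  forall alphae alphac : R, 0 < alphae < 1 -> 0 < alphac < 1 ->
  ((1 - (alphae + alphac))%:E <=
     limn_einf (fun N => P [set w | (`|S - V N w| <=
       q alphae * (sigmae / Num.sqrt (psi N)%:R)
       + q alphac * (sigmac / Num.sqrt N%:R))%R]))%E
  /\
  forall hsigmae hsigmac : nat -> {RV P >-> R},
    cvg_in_probability P (fun N => hsigmae N : T -> R) sigmae ->
    cvg_in_probability P (fun N => hsigmac N : T -> R) sigmac ->
    (sigmac = 0 -> forall N w, 0 <= hsigmac N w) ->
    ((1 - (alphae + alphac))%:E <=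
       limn_einf (fun N => P [set w | (`|S - V N w| <=
         q alphae * (hsigmae N w / Num.sqrt (psi N)%:R)
         + q alphac * (hsigmac N w / Num.sqrt N%:R))%R]))%E.
Proof.
move=> Y Y' Yc Yc' S Sc mY mYc A B Ac Bc D Dc V iXZ lZ iZ' vY vY0 vYc vYc0
  ceY ceYc vD vDc cAAc cABc cBAc cBBc sc0 scE se0 seE psioo iids iidt
  alphae alphac aE aC.
(* The first claim is the second one for constant estimators. *)
suff main : forall hsigmae hsigmac : nat -> {RV P >-> R},
    cvg_in_probability P (fun N => hsigmae N : T -> R) sigmae ->
    cvg_in_probability P (fun N => hsigmac N : T -> R) sigmac ->
    (sigmac = 0 -> forall N w, 0 <= hsigmac N w) ->
    ((1 - (alphae + alphac))%:E <=
       limn_einf (fun N => P [set w | (`|S - V N w| <=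
         q alphae * (hsigmae N w / Num.sqrt (psi N)%:R)
         + q alphac * (hsigmac N w / Num.sqrt N%:R))%R]))%E.
  split; last exact: main.
  apply: (main (fun=> rv P (@measurable_cst _ _ _ _ setT sigmae))
              (fun=> rv P (@measurable_cst _ _ _ _ setT sigmac))).
  - exact: cvg_in_probability_cst.
  - exact: cvg_in_probability_cst.
  - by move=> _ N w /=.
move=> hse hsc hsecvg hsccvg hsc0.
pose fe (v : p1.-tuple R * p2.-tuple R) : R := eta (concat v.1 v.2).
pose fc (v : p1.-tuple R * p2.-tuple R) : R := etac (concat v.1 v.2).
have mfe : measurable_fun setT fe.
  by apply: measurableT_comp => //; exact: measurable_concat.
have mfc : measurable_fun setT fc.
  by apply: measurableT_comp => //; exact: measurable_concat.
pose v := var P Y; pose vc := var P Yc.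
have mW : measurable_fun setT (fun w => (X w, Z w, Z' w)).
  by apply: measurable_fun_pair => //; exact: measurable_fun_pair.
pose W := rv P mW.
have He : pick_freeze_pair P W (output1 fe) (output2 fe) mY v S :=
  pick_freeze_pair_outputs iXZ lZ iZ' mfe vY vY0 ceY.
have Hc : pick_freeze_pair P W (output1 fc) (output2 fc) mYc vc Sc :=
  pick_freeze_pair_outputs iXZ lZ iZ' mfc vYc vYc0 ceYc.
have v0 : 0 < v := pair_var_gt0 He.
have vc0 : 0 < vc := pair_var_gt0 Hc.
pose le := first_order (output1 fe) (output2 fe) mY S.
pose lc := first_order (output1 fc) (output2 fc) mYc Sc.
have mle : measurable_fun setT le := measurable_first_order He.
have mlc : measurable_fun setT lc := measurable_first_order Hc.
have mleW : measurable_fun setT (fun w => le (W w)) by exact: measurableT_comp.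
have mlcW : measurable_fun setT (fun w => lc (W w)) by exact: measurableT_comp.
have le0 : \int[P]_w le (W w) = 0 := first_order_mean0 He.
have lc0 : \int[P]_w lc (W w) = 0 := first_order_mean0 Hc.
have le2 : itg P (fun w => le (W w) ^+ 2).
  by apply: (eq_itg (variance_itg mleW vD)) => w; rewrite le0 subr0.
have lc2 : itg P (fun w => lc (W w) ^+ 2).
  by apply: (eq_itg (variance_itg mlcW vDc)) => w; rewrite lc0 subr0.
have varD : var P D = \int[P]_w (le (W w) ^+ 2).
  rewrite varE -[\int[P]_w D w]/(\int[P]_w le (W w)) le0.
  by apply: eq_Rintegral => w _; rewrite subr0.
have varDc : var P Dc = \int[P]_w (lc (W w) ^+ 2).
  rewrite varE -[\int[P]_w Dc w]/(\int[P]_w lc (W w)) lc0.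
  by apply: eq_Rintegral => w _; rewrite subr0.
have covD : 2 * \int[P]_w (le (W w) * lc (W w)) =
    2 * cov P A Ac - (cov P A Bc + cov P B Ac) + cov P B Bc / 2.
  have [mA mB] := measurable_pair_products He.
  have [mAc mBc] := measurable_pair_products Hc.
  have iAA := covariance_itg mA mAc cAAc; have iAB := covariance_itg mA mBc cABc.
  have iBA := covariance_itg mB mAc cBAc; have iBB := covariance_itg mB mBc cBBc.
  (* D and Dc are centred, so A and B may be centred separately in D Dc. *)
  have lcE w : 2 * (le (W w) * lc (W w)) =
      (2 * ((A w - \int[P]_w A w) * (Ac w - \int[P]_w Ac w))
       - ((A w - \int[P]_w A w) * (Bc w - \int[P]_w Bc w)
          + (B w - \int[P]_w B w) * (Ac w - \int[P]_w Ac w)))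
      + 2^-1 * ((B w - \int[P]_w B w) * (Bc w - \int[P]_w Bc w)).
    have -> : \int[P]_w A w = S * v := pair_cov He.
    have -> : \int[P]_w Ac w = Sc * vc := pair_cov Hc.
    have -> : \int[P]_w B w = 2 * (S * v) := mean_pair_squares He.
    have -> : \int[P]_w Bc w = 2 * (Sc * vc) := mean_pair_squares Hc.
    have -> : le (W w) = A w - B w / 2 by [].
    have -> : lc (W w) = Ac w - Bc w / 2 by [].
    by field.
  rewrite -meanZ; last exact: itg_mul.
  under eq_Rintegral do rewrite lcE.
  rewrite meanD; [|by apply: itgB; [exact: itgZ|exact: itgD]|exact: itgZ].
  rewrite meanB; [|exact: itgZ|exact: itgD].
  by rewrite (meanZ 2 iAA) (meanZ 2^-1 iBB) (meanD iAB iBA) !covE [_ / 2]mulrC.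
have ilelc : itg P (fun w => le (W w) * lc (W w)) by exact: itg_mul.
(* The correction compares the two statistics on the same sample, so its
   first-order term is the difference of theirs, of variance sigmae^2; he is
   this difference divided by sigmae. *)
pose he u := (sigmae * v)^-1 * le u + (- (sigmae * vc)^-1) * lc u.
have mhe : measurable_fun setT he.
  by apply: measurable_funD; apply: measurable_funM.
have heE w : he (W w) ^+ 2 = ((sigmae * v)^-1 ^+ 2 * le (W w) ^+ 2 +
    (sigmae * vc)^-1 ^+ 2 * lc (W w) ^+ 2)
    - (2 * (sigmae * v)^-1 * (sigmae * vc)^-1) * (le (W w) * lc (W w)).
  by rewrite /he; ring.
have i1 := itgZ ((sigmae * v)^-1 ^+ 2) le2.
have i2 := itgZ ((sigmae * vc)^-1 ^+ 2) lc2.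
have i3 := itgZ (2 * (sigmae * v)^-1 * (sigmae * vc)^-1) ilelc.
have he2 : itg P (fun w => he (W w) ^+ 2).
  by apply: (eq_itg (itgB (itgD i1 i2) i3)) => w; rewrite heE.
have ile := itg_sqr mleW le2; have ilc := itg_sqr mlcW lc2.
have he0 : \int[P]_w he (W w) = 0.
  rewrite meanD; [|exact: itgZ|exact: itgZ].
  by rewrite !meanZ// le0 lc0 !mulr0 addr0.
have he1 : \int[P]_w (he (W w) ^+ 2) = 1.
  under eq_Rintegral do rewrite heE.
  rewrite meanB//; last exact: itgD.
  rewrite meanD// !meanZ// -varD -varDc.
  have : \int[P]_w (le (W w) * lc (W w)) =
      (2 * cov P A Ac - (cov P A Bc + cov P B Ac) + cov P B Bc / 2) / 2.
    by rewrite -covD; field.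
  move=> ->; move: seE; rewrite scE -/v -/vc => seE.
  have e1 : sigmae ^+ 2 != 0 by rewrite expf_neq0// gt_eqF.
  apply: (mulfI e1); rewrite mulr1 [in RHS]seE; field.
  by rewrite !gt_eqF.
pose Ge N w := (pick_freeze_of eta (fun i => t N i w) - S) -
  (pick_freeze_of etac (fun i => t N i w) - Sc).
have lin_e : to_prob P (fun N w => Num.sqrt (psi N)%:R *
    (pick_freeze_of eta (fun i => t N i w) - S) - v^-1 * nsum t le N w) 0 :=
  pick_freeze_linear (W := W) iidt psioo He le2.
have lin_c : to_prob P (fun N w => Num.sqrt (psi N)%:R *
    (pick_freeze_of etac (fun i => t N i w) - Sc) - vc^-1 * nsum t lc N w) 0 :=
  pick_freeze_linear (W := W) iidt psioo Hc lc2.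
have Ge0 : to_prob P (fun N w => Num.sqrt (psi N)%:R * Ge N w - sigmae * nsum t he N w) 0.
  rewrite -(addr0 0); move: lin_c => /(to_probZ (-1)); rewrite mulr0 => lin_c.
  apply: to_prob_near (to_probD lin_e lin_c); apply: nearW => N w.
  rewrite /he nsum_linear /Ge; field.
  by rewrite !gt_eqF.
have bad_e := confidence (W := W) iidt psioo mhe he2 he0 he1 se0 Ge0
  (cvg_in_probability_to_prob hsecvg) aE.
pose Gc N w := pick_freeze_of etac (fun i => s N i w) - Sc.
have idoo : (fun N : nat => N) @ \oo --> \oo by exact: cvg_id.
have bad_c : asymp_le P (fun N => [set w |
    ~ (`|Gc N w| <= q alphac * (hsc N w / Num.sqrt N%:R))]) alphac.
  (* If sigmac = 0, a normal limit at scale 1 / sqrt N gives no bound, but the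
     estimator of Sc is then exact. *)
  move: sc0; rewrite le_eqVlt => /predU1P[sc0|sc0].
    have lc20 : \int[P]_w (lc (W w) ^+ 2) = 0.
      rewrite -varDc; move: scE; rewrite -sc0 expr0n /= => /esym/eqP.
      rewrite mulf_eq0 invr_eq0 sqrf_eq0 -/vc (gt_eqF vc0) orbF => /eqP //.
    have Sc1 : Sc = 1.
      apply: (degenerate_ratio iXZ lZ iZ' mfc (pair_sqr1 Hc) (pair_var1 Hc) vc0 (pair_cov Hc)) => //.
      by rewrite divr_ge0 ?var_ge0.
    have H1 := pick_freeze_degenerate (n := fun N => N) (xi := s) (W := W) iids idoo Hc lc2 Sc1 lc20.
    apply: (@asymp_le_ge _ _ _ _ _ 0); first by move: aC => /andP[/ltW].
    apply: asymp_le_sub H1 => N w /= H2 H3; apply: H2.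
    rewrite /Gc /pick_freeze_of [X in `|X - _|]H3 Sc1 subrr normr0.
    rewrite mulr_ge0 ?(ltW (q_gt0 aC))// divr_ge0 ?sqrtr_ge0//.
    by apply: hsc0; rewrite -sc0.
  pose hc u := (sigmac * vc)^-1 * lc u.
  have mhc : measurable_fun setT hc by exact: measurable_funM.
  have hcE w : hc (W w) ^+ 2 = (sigmac * vc)^-1 ^+ 2 * lc (W w) ^+ 2 by rewrite exprMn.
  have hc2 : itg P (fun w => hc (W w) ^+ 2).
    by apply: (eq_itg (itgZ ((sigmac * vc)^-1 ^+ 2) lc2)) => w; rewrite hcE.
  have hc0 : \int[P]_w hc (W w) = 0 by rewrite meanZ// lc0 mulr0.
  have hc1 : \int[P]_w (hc (W w) ^+ 2) = 1.
    under eq_Rintegral do rewrite hcE.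
    rewrite meanZ// -varDc.
    have e1 : sigmac ^+ 2 != 0 by rewrite expf_neq0// gt_eqF.
    apply: (mulfI e1); rewrite mulr1 [in RHS]scE -/vc; field.
    by rewrite !gt_eqF.
  apply: (confidence (n := fun N => N) (xi := s) (W := W) iids idoo mhc hc2 hc0 hc1 sc0 _
    (cvg_in_probability_to_prob hsccvg) aC).
  have lin_s : to_prob P (fun N w => Num.sqrt N%:R * Gc N w - vc^-1 * nsum s lc N w) 0 :=
    pick_freeze_linear (n := fun N => N) (xi := s) (W := W) iids idoo Hc lc2.
  apply: to_prob_near lin_s.
  apply: nearW => N w; rewrite /hc.
  have -> : nsum s (fun u => (sigmac * vc)^-1 * lc u) N w = (sigmac * vc)^-1 * nsum s lc N w.
    by rewrite /nsum -mulr_sumr; ring.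
  by field; rewrite !gt_eqF.
apply: asymp_le_liminf => [N|].
  rewrite -[X in measurable X]setTI; apply: measurable_fun_le => //.
    apply: measurableT_comp => //; apply: measurable_funB => //.
    apply: measurable_funD; first exact: measurable_pick_freeze_of.
    by apply: measurable_funB; exact: measurable_pick_freeze_of.
  by apply: measurable_funD; apply: measurable_funM => //; apply: measurable_funM.
apply: asymp_le_sub (asymp_leU bad_e bad_c) => N w /= H.
apply: contrapT => /not_orP[/contrapT H1 /contrapT H2]; apply: H.
apply: le_trans (lerD H1 H2).
have -> : S - V N w = - (Ge N w + Gc N w).
  by rewrite /V /reduced_estimator /Ge /Gc; ring.
by rewrite normrN; exact: ler_normD.
Qed.
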